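(* Let $\mathcal{A}$ be a C*-algebra and let $E,F$ be Hilbert $\mathcal{A}$-modules. On the space $R(E,F)$ of regular operators from $E$ to $F$, the Riesz topology is stronger than the gap topology (i.e. every gap-open set is Riesz-open).
   Context: $\mathcal{A}$ is an arbitrary (not necessarily unital) C*-algebra. Hilbert $\mathcal{A}$-modules are left modules with $\mathcal{A}$-valued inner product that is $\mathcal{A}$-linear in the first variable. A regular operator $t:Dom(t)\subseteq E\to F$ is a closed $\mathcal{A}$-linear operator with dense domain whose adjoint $t^*$ is densely defined and for which $1+t^*t$ has dense range in $E$; $R(E,F)$ is the set of them. For $t\in R(E,F)$ the bounded transform is $F_t=t(1+t^*t)^{-1/2}\in B(E,F)$ ($B(E,F)$ being the bounded adjointable operators). The graph $G(t)=\{(x,tx):x\in Dom(t)\}$ is orthogonally complemented in $E\oplus F$, with orthogonal projection $P_{G(t)}$ onto it. The Riesz topology on $R(E,F)$ is induced by the metric $\sigma(t,s)=\|F_t-F_s\|$; the gap topology is induced by the metric $d(t,s)=\|P_{G(t)}-P_{G(s)}\|$. *)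

(* Defs.v *)
From HB Require Import structures.
From mathcomp Require Import all_boot all_order all_algebra.
From mathcomp Require Import complex.
From mathcomp Require Import all_classical all_reals all_analysis.
Set Implicit Arguments.
Unset Strict Implicit.
Unset Printing Implicit Defensive.
Import Order.TTheory GRing.Theory Num.Theory.
Import numFieldNormedType.Exports.
Local Open Scope classical_set_scope.
Local Open Scope ring_scope.
Local Open Scope complex_scope.

(* A need not be unital, so its product is not MathComp's ring product. *)
HB.mixin Record isCStarAlgebra (R : realType) A
    of CompleteNormedModule R[i] A := {
  cmul : A -> A -> A ;
  cstar : A -> A ;
  cmulA : forall a b c, cmul a (cmul b c) = cmul (cmul a b) c ;
  cmulDl : forall a b c, cmul (a + b) c = cmul a c + cmul b c ;
  cmulDr : forall a b c, cmul a (b + c) = cmul a b + cmul a c ;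
  cmulZl : forall (k : R[i]) a b, cmul (k *: a) b = k *: cmul a b ;
  cmulZr : forall (k : R[i]) a b, cmul a (k *: b) = k *: cmul a b ;
  cstarK : forall a, cstar (cstar a) = a ;
  cstarD : forall a b, cstar (a + b) = cstar a + cstar b ;
  cstarZ : forall (k : R[i]) a, cstar (k *: a) = k^* *: cstar a ;
  cstarM : forall a b, cstar (cmul a b) = cmul (cstar b) (cstar a) ;
  cnormM : forall a b, `|cmul a b| <= `|a| * `|b| ;
  cnorm_star : forall a, `|cmul (cstar a) a| = `|a| ^+ 2 }.

#[short(type="cstarType")]
HB.structure Definition CStarAlgebra (R : realType) :=
  { A of isCStarAlgebra R A & CompleteNormedModule R[i] A }.

(* [ip_norm] makes the Banach space norm the one induced by the inner product;
   in particular it gives definiteness of the inner product. *)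
HB.mixin Record isHilbertModule (R : realType) (A : cstarType R) E
    of CompleteNormedModule R[i] E := {
  act : A -> E -> E ;
  ip : E -> E -> A ;
  actM : forall a b x, act (cmul a b) x = act a (act b x) ;
  actDl : forall a b x, act (a + b) x = act a x + act b x ;
  actDr : forall a x y, act a (x + y) = act a x + act a y ;
  actZl : forall (k : R[i]) a x, act (k *: a) x = k *: act a x ;
  actZr : forall (k : R[i]) a x, act a (k *: x) = k *: act a x ;
  ipD : forall x y z, ip (x + y) z = ip x z + ip y z ;
  ipZ : forall (k : R[i]) x y, ip (k *: x) y = k *: ip x y ;
  ip_act : forall a x y, ip (act a x) y = cmul a (ip x y) ;
  ip_star : forall x y, cstar (ip x y) = ip y x ;
  ip_ge0 : forall x, exists b, ip x x = cmul (cstar b) b ;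
  ip_norm : forall x, `|x| ^+ 2 = `|ip x x| }.

#[short(type="hilbertModType")]
HB.structure Definition HilbertModule (R : realType) (A : cstarType R) :=
  { E of isHilbertModule R A E & CompleteNormedModule R[i] E }.

(* Norms take values in R[i]; this is the norm as an element of R. *)
Definition rnorm (R : realType) (V : normedModType R[i]) (x : V) : R :=
  complex.Re `|x|.

Definition opnorm (R : realType) (U V : Type) (nU : U -> R) (nV : V -> R)
    (T : U -> V) : R :=
  sup [set nV (T u) | u in [set u | nU u <= 1]].

Section HilbertModules.
Context {R : realType} {A : cstarType R}.
Implicit Types E F : hilbertModType A.

(* The Hilbert module E (+) F.  The library norm on E * F is the (equivalent)
   max norm, so the Hilbert module norm is given separately. *)
Definition sum_ip E F (u v : E * F) : A := ip u.1 v.1 + ip u.2 v.2.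

Definition sum_norm E F (u : E * F) : R := Num.sqrt (rnorm (sum_ip u u)).

(* An unbounded operator from E to F is identified with its graph,
   a subset of E * F. *)
Definition dom E F (t : set (E * F)) : set E := [set x | exists y, t (x, y)].

Definition ran E F (t : set (E * F)) : set F := [set y | exists x, t (x, y)].

Definition linear_op E F (t : set (E * F)) : Prop :=
  [/\ forall x y y', t (x, y) -> t (x, y') -> y = y',
      t (0, 0),
      forall x y x' y', t (x, y) -> t (x', y') -> t (x + x', y + y'),
      forall (k : R[i]) x y, t (x, y) -> t (k *: x, k *: y) &
      forall (a : A) x y, t (x, y) -> t (act a x, act a y)].

Definition adjoint E F (t : set (E * F)) : set (F * E) :=
  [set yz | forall x w, t (x, w) -> ip w yz.1 = ip x yz.2].

(* 1 + t^* t, with domain {x in Dom t | t x in Dom t^*} *)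
Definition one_plus E F (t : set (E * F)) : set (E * E) :=
  [set xv | exists y z, [/\ t (xv.1, y), adjoint t (y, z) & xv.2 = xv.1 + z]].

Definition regular E F (t : set (E * F)) : Prop :=
  [/\ linear_op t, closed t, dense (dom t),
      dense (dom (adjoint t)) & dense (ran (one_plus t))].

(* Additivity, homogeneity and A-linearity of T and T' follow from the
   adjunction identity. *)
Definition adjointable_pair E F (T : E -> F) (T' : F -> E) : Prop :=
  (exists M : R[i], forall x, `|T x| <= M * `|x|) /\
  (forall x y, ip (T x) y = ip x (T' y)).

(* positive elements of the C*-algebra B(E, E), in the form B^* B *)
Definition positive_op E (S : E -> E) : Prop :=
  exists B B' : E -> E, adjointable_pair B B' /\ S = B' \o B.

(* S = (1 + t^* t)^{-1/2}: the positive square root of (1 + t^* t)^{-1},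
   the equation S^2 = (1 + t^* t)^{-1} being an equality of graphs *)
Definition is_inv_sqrt E F (t : set (E * F)) (S : E -> E) : Prop :=
  positive_op S /\ forall v x, S (S v) = x <-> one_plus t (x, v).

(* The default values of [xget] below are never used when t is regular:
   a unique element satisfying the given condition then exists. *)
Definition inv_sqrt E F (t : set (E * F)) : E -> E :=
  xget (fun=> 0) [set S | is_inv_sqrt t S].

Definition op_app E F (t : set (E * F)) (x : E) : F :=
  xget 0 [set y | t (x, y)].

Definition bounded_transform E F (t : set (E * F)) : E -> F :=
  op_app t \o inv_sqrt t.

Definition proj E F (G : set (E * F)) (u : E * F) : E * F :=
  xget 0 [set g | G g /\ forall h, G h -> sum_ip (u - g) h = 0].

Definition regop E F := {t : set (E * F) | regular t}.

Definition riesz_dist E F (t s : regop E F) : R :=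
  opnorm (@rnorm R E) (@rnorm R F)
    (bounded_transform (sval t) \- bounded_transform (sval s)).

Definition gap_dist E F (t s : regop E F) : R :=
  opnorm (@sum_norm E F) (@sum_norm E F)
    (proj (sval t) \- proj (sval s)).

End HilbertModules.

Definition metric_open (R : realType) (T : Type) (d : T -> T -> R)
    (U : set T) : Prop :=
  forall t, U t -> exists2 e, 0 < e & [set s | d t s < e] `<=` U.

(* Main.v *)
(* For regular t put P = (1 + t^* t)^{-1}, S = P^{1/2} and F = t S.  Then
   S^2 + F^* F = 1 and the graph of t is the range of the isometry
   V v = (S v, F v), so the projection onto the graph is V V^*.  As S is the
   square root of 1 - F^* F, and square roots of 1 - X for self-adjoint
   contractions X are uniform limits of polynomials in X, S and hence V V^*
   depend continuously on F.

   The C*-algebra theory needed is elementary.  For self-adjoint h with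
   |h| <= 1 the operator h + i (1 - h^2)^{1/2} is unitary, which gives
   |1 - h^2| <= 1; this makes the cone of positive operators, defined by
   |M - T| <= M for some M > 0, coincide with the squares of self-adjoint
   operators.  A acts on itself by right multiplication, which replaces the
   unitization of A. *)

Require Import Defs.
From HB Require Import structures.
From mathcomp Require Import all_boot all_order all_algebra.
From mathcomp Require Import complex.
From mathcomp Require Import all_classical all_reals all_analysis.
From mathcomp Require Import ring lra.

Set Implicit Arguments.
Unset Strict Implicit.
Unset Printing Implicit Defensive.
Import Order.TTheory GRing.Theory Num.Theory.
Import numFieldNormedType.Exports.
Local Open Scope classical_set_scope.
Local Open Scope ring_scope.
Local Open Scope complex_scope.

(** The cone serves mainly to show that [ip x x] has norm at most that of [ip x x + ip y y]. This
    makes the resolvent, [S] and [F] contractions, and it rests on the positivity of the elements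
    [b^* b]. The classical proof of that compares the spectra of [c c^*] and [c^* c]; here a norm
    estimate takes its place: if [- c c^*] is positive, every bound on it can be halved, so it
    vanishes.

    Cauchy-Schwarz with constant 1 enters only in that estimate, on [A] itself, where it is
    submultiplicativity of the norm. On a general module polarization gives the constant 4, which
    spreads through the later bounds; this is harmless when only topologies are compared.

    As [t] is unbounded, neither [F] nor its adjoint comes as a composite of bounded operators. Each
    is first controlled on a dense subspace, the range of [S] for [F] and the domain of [t^*] for
    its adjoint, and then extended by continuity.

    No Lipschitz estimate results: the [n]-th approximation of the square root multiplies the
    distance by [n], so [n] must be fixed before the radius. *)

Lemma addr_extract (V : zmodType) (v s s' x : V) :
  s = s' + x -> s + v = (s' + v) + x.
Proof. by move=> ->; rewrite addrAC. Qed.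

Lemma addr_cancel (V : zmodType) (s s' x : V) : s = s' + x -> s - x = s'.
Proof. by move=> ->; rewrite addrK. Qed.

Lemma addr_cancelN (V : zmodType) (s s' x : V) : s = s' - x -> s + x = s'.
Proof. by move=> ->; rewrite subrK. Qed.

(** Yields a proof of [s = s' + x], where [s'] is the sum [s] without one summand that [same]
    identifies with [x]. The inner [match goal] runs the tactic [same] while the term is being
    built. *)
Ltac addr_find same x s :=
  match s with
  | ?u + ?y =>
      let _ := match goal with _ => same x y end in constr:(erefl s)
  | ?u + ?v => let p := addr_find same x u in constr:(addr_extract v p)
  | ?y => let _ := match goal with _ => same x y end in constr:(esym (add0r s))
  end.

Ltac addr_findN same x s :=
  match s with
  | ?u - ?y =>
      let _ := match goal with _ => same x y end in constr:(erefl s)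
  | ?u + ?v => let p := addr_findN same x u in constr:(addr_extract v p)
  | - ?y => let _ := match goal with _ => same x y end in constr:(esym (add0r s))
  end.

Ltac addr_cancel_last same :=
  match goal with
  | |- is_true (?s - ?x == 0) =>
      let p := addr_find same x s in rewrite (addr_cancel p)
  | |- is_true (?s + ?x == 0) =>
      let p := addr_findN same x s in rewrite (addr_cancelN p)
  end.

Ltac same_syntax x y := constr_eq x y.
Ltac same_conv x y := unify x y.

(* Decides equations that hold in every abelian group. *)
Ltac zmod_eq :=
  apply/eqP; rewrite -subr_eq0 ?(opprD, opprK, oppr0, addr0, add0r) ?addrA;
  repeat (first [addr_cancel_last same_syntax | addr_cancel_last same_conv];
          rewrite ?add0r);
  exact: eqxx.

Lemma scale_half (R : realType) (V : lmodType R[i]) (x : V) :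
  (2^-1 : R)%:C *: (x + x) = x.
Proof.
rewrite scalerDr -scalerDl -rmorphD /= (_ : 2^-1 + 2^-1 = 1 :> R) ?scale1r //.
by rewrite -div1r -splitr.
Qed.

Lemma scaleCD (R : realType) (V : lmodType R[i]) (a b : R) (x : V) :
  (a + b)%:C *: x = a%:C *: x + b%:C *: x.
Proof. by rewrite rmorphD /= scalerDl. Qed.

Lemma scaleCC (R : realType) (V : lmodType R[i]) (a b : R) (x : V) :
  a%:C *: (b%:C *: x) = (a * b)%:C *: x.
Proof. by rewrite scalerA rmorphM. Qed.

(** * Real-valued norms *)

Section NormedModules.
Context {R : realType} {V : normedModType R[i]}.
Implicit Types (x y z : V) (r : R).

Lemma rnormE x : (rnorm x)%:C = `|x|.
Proof. by rewrite /rnorm RRe_real // normr_real. Qed.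

Lemma rnorm_ge0 x : 0 <= rnorm x.
Proof. by rewrite -lecR rnormE normr_ge0. Qed.

Lemma rnorm0 : rnorm (0 : V) = 0.
Proof. by rewrite /rnorm normr0. Qed.

Lemma rnorm_eq0 x : rnorm x = 0 -> x = 0.
Proof. by move=> x0; apply/eqP; rewrite -normr_eq0 -rnormE x0. Qed.

Lemma rnorm_le0 x : rnorm x <= 0 -> x = 0.
Proof.
by move=> x0; apply: rnorm_eq0; apply/eqP; rewrite eq_le x0 rnorm_ge0.
Qed.

Lemma rnormD x y : rnorm (x + y) <= rnorm x + rnorm y.
Proof. by rewrite -lecR rmorphD /= !rnormE ler_normD. Qed.

Lemma rnormN x : rnorm (- x) = rnorm x.
Proof. by rewrite /rnorm normrN. Qed.

Lemma rdistC x y : rnorm (x - y) = rnorm (y - x).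
Proof. by rewrite -rnormN opprB. Qed.

Lemma rnormB x y : rnorm (x - y) <= rnorm x + rnorm y.
Proof. by rewrite -[rnorm y]rnormN rnormD. Qed.

Lemma rdistD z x y : rnorm (x - y) <= rnorm (x - z) + rnorm (z - y).
Proof. by rewrite (le_trans _ (rnormD _ _)) // addrA subrK. Qed.

Lemma rnormZC (k : R[i]) x : rnorm (k *: x) = complex.Re `|k| * rnorm x.
Proof.
by apply: complexI; rewrite rmorphM /= !rnormE normrZ; congr (_ * _).
Qed.

Lemma rnormZ r x : rnorm (r%:C *: x) = `|r| * rnorm x.
Proof. by rewrite rnormZC normc_def /= expr0n addr0 sqrtr_sqr. Qed.

Lemma rnormZ_ge0 r x : 0 <= r -> rnorm (r%:C *: x) = r * rnorm x.
Proof. by move=> r0; rewrite rnormZ ger0_norm. Qed.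

Lemma rnormiZ x : rnorm ('i *: x) = rnorm x.
Proof. by rewrite rnormZC normc_def /= expr0n add0r expr1n sqrtr1 mul1r. Qed.

Lemma rnorm_small x (c : R) :
  (forall e, 0 < e -> rnorm x <= c * e) -> x = 0.
Proof.
move=> xc; apply: rnorm_le0; rewrite leNgt; apply/negP => x0.
have c0 : 0 < `|c| + 1 by rewrite ltr_wpDl.
(* For this [e] the bound [c * e] is below half of [rnorm x]. *)
have e0 : 0 < rnorm x / (`|c| + 1) / 2 by rewrite !divr_gt0.
have E : rnorm x = (rnorm x / (`|c| + 1) / 2) * (2 * (`|c| + 1)).
  by field; rewrite gt_eqF.
have := le_trans (xc _ e0) (ler_wpM2r (ltW e0) (ler_norm c)).
have : 0 <= `|c| * (rnorm x / (`|c| + 1) / 2) by rewrite mulr_ge0 // ltW.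
move: e0 E; move: (_ / 2) => e; move: `|c| (rnorm x) => k r.
by rewrite mulrDr mulr1 => *; nra.
Qed.

Lemma realC_gt0P (e : R[i]) : 0 < e -> exists2 r : R, 0 < r & e = r%:C.
Proof.
move=> e0; exists (complex.Re e); last by rewrite RRe_real // gtr0_real.
by rewrite -ltcR RRe_real // gtr0_real.
Qed.

Lemma closed_rnorm (D : set V) x : closed D ->
  (forall e : R, 0 < e -> exists2 y, D y & rnorm (x - y) < e) -> D x.
Proof.
move=> cD xD; apply: cD => B /nbhs_normP[e /= /realC_gt0P[r r0 ->] eB].
have [y Dy xy] := xD _ r0; exists y; split=> //; apply: eB => /=.
by rewrite -rnormE ltcR.
Qed.

Lemma dense_rnorm (D : set V) x (e : R) : dense D -> 0 < e ->
  exists2 y, D y & rnorm (x - y) < e.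
Proof.
move=> dD e0; have /dD : ball x e%:C !=set0.
  by exists x; apply: ballxx; rewrite ltcR.
case; first exact: ball_open.
move=> y [xy Dy]; exists y => //.
by move: xy; rewrite -ball_normE /ball_ /= -rnormE ltcR.
Qed.

End NormedModules.

Lemma closed_prod_rnorm (R : realType) (V W : normedModType R[i])
    (D : set (V * W)) x y : closed D ->
  (forall e : R, 0 < e -> exists x' y',
    [/\ D (x', y'), rnorm (x - x') < e & rnorm (y - y') < e]) -> D (x, y).
Proof.
move=> cD xyD; apply: (closed_rnorm cD) => e /xyD[x' [y' [D' xx' yy']]].
exists (x', y') => //; rewrite -ltcR rnormE prod_normE /= -!rnormE /Order.max.
by case: ifP => _; rewrite ltcR.
Qed.

Lemma complete_rnorm (R : realType) (V : completeNormedModType R[i])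
    (u : nat -> V) :
  (forall e : R, 0 < e -> exists N, forall n m, (N <= n)%N -> (N <= m)%N ->
    rnorm (u n - u m) < e) ->
  exists l, forall e : R, 0 < e -> exists N, forall n, (N <= n)%N ->
    rnorm (l - u n) < e.
Proof.
move=> uC; have /cauchy_cvgP/cvg_ex[l ul] : cauchy (u @ \oo).
  apply: cauchy_exP => e /realC_gt0P[r r0 ->].
  have [N uN] := uC _ r0; exists (u N); exists N => // n /= Nn.
  by rewrite -ball_normE /ball_ /= -rnormE ltcR uN.
exists l => e e0; move/cvgrPdist_lt : ul => /(_ e%:C); rewrite ltcR => /(_ e0).
by case=> N _ uN; exists N => n /uN /=; rewrite -rnormE ltcR.
Qed.

(** * Inner products and adjoints *)

Section CStarBasics.
Context {R : realType} {A : cstarType R}.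
Implicit Types a b : A.

Lemma rnorm_cmul a b : rnorm (cmul a b) <= rnorm a * rnorm b.
Proof. by rewrite -lecR rmorphM /= !rnormE cnormM. Qed.

Lemma rnorm_cstar_cmul a : rnorm (cmul (cstar a) a) = rnorm a ^+ 2.
Proof. by apply: complexI; rewrite rmorphXn /= !rnormE cnorm_star. Qed.

Lemma rnorm_cstar a : rnorm (cstar a) = rnorm a.
Proof.
suff le b : rnorm b <= rnorm (cstar b).
  by apply/eqP; rewrite eq_le -{2}[a]cstarK !le.
have [->|b0] := eqVneq b 0; first by rewrite rnorm0 rnorm_ge0.
have rb0 : 0 < rnorm b.
  by rewrite lt_neqAle rnorm_ge0 andbT eq_sym; apply: contra_neq b0; apply: rnorm_eq0.
by have := rnorm_cmul (cstar b) b; rewrite rnorm_cstar_cmul expr2 ler_pM2r.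
Qed.

End CStarBasics.

Lemma conj_realC (R : realType) (r : R) : Num.conj (r%:C : R[i]) = r%:C.
Proof. exact: conjc_real. Qed.

Lemma conj_imag (R : realType) : Num.conj ('i : R[i]) = - 'i.
Proof. by apply/eqP; rewrite eq_complex /= oppr0 !eqxx. Qed.

Section InnerProduct.
Context {R : realType} {A : cstarType R} {E : hilbertModType A}.
Implicit Types (x y z : E) (r : R) (k : R[i]).

Lemma ipNl x z : ip (- x) z = - ip x z.
Proof. by rewrite -scaleN1r ipZ scaleN1r. Qed.

Lemma ipBl x y z : ip (x - y) z = ip x z - ip y z.
Proof. by rewrite ipD ipNl. Qed.

Lemma ip0l z : ip 0 z = 0.
Proof. by rewrite -[0 in LHS](scale0r z) ipZ scale0r. Qed.

Lemma ipDr x y z : ip z (x + y) = ip z x + ip z y.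
Proof. by rewrite -ip_star ipD cstarD !ip_star. Qed.

Lemma ipZr k x z : ip z (k *: x) = Num.conj k *: ip z x.
Proof. by rewrite -ip_star ipZ cstarZ ip_star. Qed.

Lemma ipZCr r x z : ip z (r%:C *: x) = r%:C *: ip z x.
Proof. by rewrite ipZr conj_realC. Qed.

Lemma ipNr x z : ip z (- x) = - ip z x.
Proof. by rewrite -ip_star ipNl -scaleN1r cstarZ rmorphN rmorph1 scaleN1r ip_star. Qed.

Lemma ipBr x y z : ip z (x - y) = ip z x - ip z y.
Proof. by rewrite ipDr ipNr. Qed.

Lemma ip0r z : ip z 0 = 0.
Proof. by rewrite -[0 in LHS](scale0r z) ipZr rmorph0 scale0r. Qed.

Lemma rnorm_ipxx x : rnorm (ip x x) = rnorm x ^+ 2.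
Proof. by apply: complexI; rewrite rmorphXn /= !rnormE ip_norm. Qed.

Lemma ipxx_eq0 x : ip x x = 0 -> x = 0.
Proof.
move=> x0; apply: rnorm_eq0; apply/eqP.
by rewrite -[_ == 0](expf_eq0 _ 2) -rnorm_ipxx x0 rnorm0.
Qed.

Lemma eq_ipr x y : (forall z, ip x z = ip y z) -> x = y.
Proof.
by move=> xy; apply/eqP; rewrite -subr_eq0; apply/eqP/ipxx_eq0; rewrite ipBl xy subrr.
Qed.

Lemma eq_ipl x y : (forall z, ip z x = ip z y) -> x = y.
Proof. by move=> xy; apply: eq_ipr => z; rewrite -ip_star xy ip_star. Qed.

Lemma ipxxD x y : ip (x + y) (x + y) = (ip x x + ip y y) + (ip x y + ip y x).
Proof. by rewrite ipD !ipDr (addrC (ip y x)) addrACA. Qed.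

Lemma ipxxB x y : ip (x - y) (x - y) = (ip x x + ip y y) - (ip x y + ip y x).
Proof. by rewrite ipxxD !ipNr !ipNl opprK -opprD. Qed.

Lemma polarization x y :
  (4%:R : R)%:C *: ip x y = (ip (x + y) (x + y) - ip (x - y) (x - y)) +
    'i *: (ip (x + 'i *: y) (x + 'i *: y) - ip (x - 'i *: y) (x - 'i *: y)).
Proof.
have dbl (s m : A) : (s + m) - (s - m) = m + m.
  by rewrite opprB addrC addrA subrK.
rewrite !ipxxB !ipxxD !dbl ipZ ipZr !scalerDr !scalerA.
rewrite conj_imag mulrN -expr2 sqr_i opprK scaleN1r scale1r.
rewrite addrACA [ip x y + ip y x + _]addrACA subrr addr0.
by rewrite rmorph_nat scaler_nat !mulrS mulr0n addr0 !addrA.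
Qed.

(* Polarization: no positivity is needed for Cauchy-Schwarz up to a constant. *)
Lemma rnorm_ip_le x y : rnorm (ip x y) <= 4 * (rnorm x * rnorm y).
Proof.
have bnd (u v : E) : rnorm (ip u v) <= (rnorm u + rnorm v) ^+ 2.
  have q (z : E) : rnorm z <= rnorm u + rnorm v ->
      rnorm (ip z z) <= (rnorm u + rnorm v) ^+ 2.
    by move=> ?; rewrite rnorm_ipxx ler_sqr ?nnegrE ?addr_ge0 ?rnorm_ge0.
  have q1 := q _ (rnormD u v); have q2 := q _ (rnormB u v).
  have := rnormD u ('i *: v); rewrite rnormiZ => /q q3.
  have := rnormB u ('i *: v); rewrite rnormiZ => /q q4.
  have : rnorm ((4%:R : R)%:C *: ip u v) <= 4 * (rnorm u + rnorm v) ^+ 2.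
    rewrite polarization (le_trans (rnormD _ _)) // rnormiZ.
    have := rnormB (ip (u + v) (u + v)) (ip (u - v) (u - v)).
    have := rnormB (ip (u + 'i *: v) (u + 'i *: v)) (ip (u - 'i *: v) (u - 'i *: v)).
    by lra.
  by rewrite rnormZ_ge0 // ler_pM2l.
have [->|x0] := eqVneq x 0; first by rewrite ip0l !rnorm0 mul0r mulr0.
have [->|y0] := eqVneq y 0; first by rewrite ip0r !rnorm0 !mulr0.
have pos (z : E) : z != 0 -> 0 < rnorm z.
  move=> z0; rewrite lt_neqAle rnorm_ge0 andbT eq_sym.
  by apply: contra_neq z0; apply: rnorm_eq0.
(* For unit vectors [bnd] gives [(1 + 1) ^+ 2], the origin of the 4. *)
have := bnd ((rnorm x)^-1%:C *: x) ((rnorm y)^-1%:C *: y).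
rewrite ipZ ipZCr !rnormZ_ge0 ?invr_ge0 ?rnorm_ge0 //.
rewrite !mulVf ?gt_eqF ?pos // mulrA -invfM mulrC ler_pdivrMr ?mulr_gt0 ?pos //.
by rewrite (_ : (1 + 1) ^+ 2 = 4) // expr2; ring.
Qed.

End InnerProduct.

Section Adjoints.
Context {R : realType} {A : cstarType R}.
Implicit Types E F G : hilbertModType A.

(** Boundedness is kept apart, in [bdd], so that real constants can be tracked; [adj T T] is
    self-adjointness. *)
Definition adj E F (T : E -> F) (T' : F -> E) : Prop :=
  forall x y, ip (T x) y = ip x (T' y).

Definition bdd E F (M : R) (T : E -> F) : Prop :=
  forall x, rnorm (T x) <= M * rnorm x.

Lemma adj_sym E F (T : E -> F) T' : adj T T' -> adj T' T.
Proof. by move=> TT' x y; rewrite -ip_star -TT' ip_star. Qed.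

Lemma adj_comp E F G (T : E -> F) T' (S : F -> G) S' :
  adj T T' -> adj S S' -> adj (S \o T) (T' \o S').
Proof. by move=> TT' SS' x y /=; rewrite SS' TT'. Qed.

Section Linearity.
Context {E F : hilbertModType A} (T : E -> F) (T' : F -> E) (TT' : adj T T').

Lemma adjD x y : T (x + y) = T x + T y.
Proof. by apply: eq_ipr => z; rewrite ipD !TT' ipD. Qed.

Lemma adjZ k x : T (k *: x) = k *: T x.
Proof. by apply: eq_ipr => z; rewrite ipZ !TT' ipZ. Qed.

Lemma adjN x : T (- x) = - T x.
Proof. by rewrite -scaleN1r adjZ scaleN1r. Qed.

Lemma adjB x y : T (x - y) = T x - T y.
Proof. by rewrite adjD adjN. Qed.

Lemma adj0 : T 0 = 0.
Proof. by rewrite -[0 in LHS](scale0r (0 : E)) adjZ scale0r. Qed.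

(** The square of [|T' y|] is [|ip (T (T' y)) y|]; the 4 is that of [rnorm_ip_le]. *)
Lemma adj_bdd M : 0 <= M -> bdd M T -> bdd (4 * M) T'.
Proof.
move=> M0 TM y; have [->|y0] := eqVneq (rnorm (T' y)) 0.
  by rewrite !mulr_ge0 ?rnorm_ge0.
have T0 : 0 < rnorm (T' y) by rewrite lt_neqAle eq_sym y0 rnorm_ge0.
rewrite -(ler_pM2r T0) -expr2 -rnorm_ipxx -TT'.
rewrite (le_trans (rnorm_ip_le _ _)) // -!mulrA ler_pM2l //.
by rewrite [X in _ <= _ * X]mulrC mulrA ler_wpM2r ?rnorm_ge0.
Qed.

End Linearity.

Lemma bdd_comp E F G (T : E -> F) (S : F -> G) M N :
  0 <= N -> bdd M T -> bdd N S -> bdd (N * M) (S \o T).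
Proof.
move=> N0 TM SN x; rewrite (le_trans (SN _)) // -mulrA.
by rewrite ler_wpM2l.
Qed.

Lemma bdd_le E F (T : E -> F) M N : M <= N -> bdd M T -> bdd N T.
Proof. by move=> MN TM x; rewrite (le_trans (TM _)) // ler_wpM2r ?rnorm_ge0. Qed.

End Adjoints.

(** * Square roots *)

(* Y_0 = 0, Y_{n+1} = (X + Y_n^2) / 2 converges to 1 - (1 - X)^{1/2}; the rate
   is governed by the scalar case X = 1, which is [root_iter1]. *)
Fixpoint root_iter (R : realType) (E : lmodType R[i]) (X : E -> E) n (x : E) : E :=
  if n is m.+1
  then (2^-1 : R)%:C *: (X x + root_iter X m (root_iter X m x)) else 0.

Fixpoint root_iter1 (R : realType) n : R :=
  if n is m.+1 then (1 + root_iter1 R m ^+ 2) / 2 else 0.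

Section RootIter1.
Context {R : realType}.
Local Notation y := (root_iter1 R).

Lemma root_iter1_01 n : 0 <= y n <= 1.
Proof.
elim: n => [|n /andP[y0 y1]]; rewrite /= ?lexx ?ler01 //.
have yy0 : 0 <= y n ^+ 2 by rewrite exprn_ge0.
have yy1 : y n ^+ 2 <= 1 by rewrite exprn_ile1.
by apply/andP; split; lra.
Qed.

Lemma root_iter1_le n k : y n <= y (k + n)%N.
Proof.
elim: k => // k /le_trans; apply => /=.
by have := sqr_ge0 (y (k + n)%N - 1); rewrite sqrrB; lra.
Qed.

(** One step turns the gap [g = 1 - y n] into [g - g^2 / 2]. While [g] stays above [e] it loses at
    least [e^2 / 2] each time, which cannot last. *)
Lemma root_iter1_cvg (e : R) : 0 < e -> exists n, 1 - y n < e.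
Proof.
move=> e0; apply: contrapT => /forallNP ye.
have dec n : 1 - y n <= 1 - n%:R * (e ^+ 2 / 2).
  elim: n => [|n IH]; first by rewrite /=; lra.
  have /negP := ye n; rewrite -leNgt -natr1 /= => {ye} ye.
  have : e ^+ 2 <= (1 - y n) ^+ 2.
    by rewrite ler_sqr ?nnegrE ?(ltW e0) // (le_trans (ltW e0)).
  by rewrite sqrrB; move: IH; rewrite mulrDl mul1r; lra.
have e2 : 0 < e ^+ 2 / 2 by rewrite divr_gt0 ?exprn_gt0.
have : 0 <= (e ^+ 2 / 2)^-1 by rewrite invr_ge0 ltW.
move=> /archi_boundP; set n := Num.Def.archi_bound _.
rewrite -(ltr_pM2r e2) mulVf ?gt_eqF // => n1.
by have := dec n; have /andP[_] := root_iter1_01 n; lra.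
Qed.
End RootIter1.

Section SquareRoot.
Context {R : realType} {A : cstarType R} {E : hilbertModType A}.
Implicit Types (X T : E -> E) (x : E).
Local Notation y := (root_iter1 R).

Lemma root_iter_adj X n : adj X X -> adj (root_iter X n) (root_iter X n).
Proof.
move=> XX; elim: n => [|n IH] u v /=; first by rewrite ip0l ip0r.
by rewrite ipZ ipZCr ipD ipDr XX !IH.
Qed.

Lemma root_iter_bdd X n : bdd 1 X -> bdd (y n) (root_iter X n).
Proof.
move=> X1; elim: n => [|n IH] x /=; first by rewrite rnorm0 mul0r.
rewrite rnormZ_ge0 ?invr_ge0 // mulrAC ler_pdivlMr // mulrC mulVKf //.
have [y0 _] := andP (@root_iter1_01 R n).
rewrite (le_trans (rnormD _ _)) // mulrDl lerD ?X1 //.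
by rewrite (le_trans (IH _)) // expr2 -mulrA ler_wpM2l.
Qed.

Lemma root_iter_bdd1 X n : bdd 1 X -> bdd 1 (root_iter X n).
Proof.
move=> X1; apply: bdd_le (root_iter_bdd n X1).
by case/andP: (@root_iter1_01 R n).
Qed.

Lemma root_iter_comm X T T' n : adj T T' ->
  (forall x, T (X x) = X (T x)) ->
  forall x, T (root_iter X n x) = root_iter X n (T x).
Proof.
move=> TT' TX; elim: n => [|n IH] x /=; first by rewrite (adj0 TT').
by rewrite (adjZ TT') (adjD TT') TX !IH.
Qed.

(** Two iterates [Z], [W] of the same [X] commute, so [Z^2 - W^2 = (Z - W) (Z + W)]. Its bound
    [(z - w) (z + w) = z^2 - w^2] is exactly what the scalar recursion produces. *)
Lemma root_iter_dist X n k : adj X X -> bdd 1 X -> forall x,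
  rnorm (root_iter X (k + n)%N x - root_iter X n x) <=
    (y (k + n)%N - y n) * rnorm x.
Proof.
move=> XX X1; elim: n k => [|n IH] k x.
  by rewrite /= !subr0; exact: root_iter_bdd.
rewrite !addnS /= -scalerBr rnormZ_ge0 ?invr_ge0 // opprD addrACA subrr add0r.
have Yadj m := root_iter_adj m XX.
have YX m z : X (root_iter X m z) = root_iter X m (X z).
  by apply: (root_iter_comm _ XX).
have YY z : root_iter X n (root_iter X (k + n)%N z) =
            root_iter X (k + n)%N (root_iter X n z).
  by apply: (root_iter_comm _ (Yadj n)) => w; rewrite YX.
have ZD := adjD (Yadj (k + n)%N); have WD := adjD (Yadj n).
set Z := root_iter X (k + n)%N in IH YY ZD *.
set W := root_iter X n in IH YY WD *.
set z := y (k + n)%N in IH *; set w := y n in IH *.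
have -> : Z (Z x) - W (W x) = (Z (Z x + W x) - W (Z x + W x)).
  by rewrite ZD WD YY opprD addrA addrK.
have b1 := IH k (Z x + W x); rewrite -/Z -/W -/z -/w in b1.
have b2 : rnorm (Z x + W x) <= (z + w) * rnorm x.
  rewrite mulrDl (le_trans (rnormD _ _)) //.
  by rewrite lerD // root_iter_bdd.
have zw : 0 <= z - w by rewrite subr_ge0 root_iter1_le.
have := le_trans b1 (ler_wpM2l zw b2).
by move: (rnorm _) (rnorm _) => a b; lra.
Qed.

(** Iterates of different operators need not commute: [Y^2 - W^2 = Y (Y - W) + (Y - W) W] has two
    terms of size [n d], and after halving the constant still grows linearly in [n]. *)
Lemma root_iter_lip X Z d n : adj X X -> bdd 1 X -> bdd 1 Z -> 0 <= d ->
  (forall x, rnorm (X x - Z x) <= d * rnorm x) ->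
  forall x, rnorm (root_iter X n x - root_iter Z n x) <= n%:R * d * rnorm x.
Proof.
move=> XX X1 Z1 d0 XZ; elim: n => [|n IH] x.
  by rewrite /= subr0 rnorm0 !mul0r.
rewrite /= -scalerBr rnormZ_ge0 ?invr_ge0 // opprD addrACA.
have YB := adjB (root_iter_adj n XX).
set Y := root_iter X n in IH YB *; set W := root_iter Z n in IH *.
have -> : Y (Y x) - W (W x) = Y (Y x - W x) + (Y (W x) - W (W x)).
  by rewrite YB addrA subrK.
have b1 := XZ x; have b2 := IH (W x).
have b3 := root_iter_bdd1 n X1 (Y x - W x); rewrite -/Y mul1r in b3.
have b4 := IH x; have b5 := root_iter_bdd1 n Z1 x; rewrite -/W mul1r in b5.
have b6 := rnormD (X x - Z x) (Y (Y x - W x) + (Y (W x) - W (W x))).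
have b7 := rnormD (Y (Y x - W x)) (Y (W x) - W (W x)).
have nd : 0 <= n%:R * d by rewrite mulr_ge0.
have b8 := ler_wpM2l nd b5.
have b9 : 0 <= d * rnorm x by rewrite mulr_ge0 ?rnorm_ge0.
by rewrite -[n.+1%:R]natr1 !mulrDl mul1r; lra.
Qed.


Lemma root_iter_lim X : adj X X -> bdd 1 X -> forall x, exists l,
  forall n, rnorm (root_iter X n x - l) <= (1 - y n) * rnorm x.
Proof.
move=> XX X1 x.
have dist n m : (n <= m)%N ->
    rnorm (root_iter X m x - root_iter X n x) <= (1 - y n) * rnorm x.
  move=> /subnK <-; rewrite (le_trans (root_iter_dist _ _ XX X1 _)) //.
  rewrite ler_wpM2r ?rnorm_ge0 // lerD2r.
  by case/andP: (@root_iter1_01 R (m - n + n)%N).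
have [e e0|l xl] := @complete_rnorm _ _ (fun n => root_iter X n x).
  have c0 : 0 < 2 * (rnorm x + 1) by rewrite mulr_gt0 // ltr_wpDl ?rnorm_ge0.
  have [N] := root_iter1_cvg (divr_gt0 e0 c0).
  rewrite ltr_pdivlMr // => Ne; exists N => n m /dist nN /dist mN.
  have := rdistD (root_iter X N x) (root_iter X n x) (root_iter X m x).
  rewrite [X in _ <= _ + X]rdistC.
  by case/andP: (@root_iter1_01 R N) => _ y1; nra.
exists l => n; apply/ler_addgt0Pr => e /xl[N Ne].
have := Ne (maxn N n) (leq_maxl _ _); have := dist _ _ (leq_maxr N n).
have := rdistD (root_iter X (maxn N n) x) (root_iter X n x) l.
by rewrite [X in _ <= X + _]rdistC [X in _ <= _ + X]rdistC; lra.
Qed.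

(* The square root of 1 - X. *)
Definition osqrt1B X x : E :=
  xget 0 [set k | forall n,
    rnorm (x - root_iter X n x - k) <= (1 - y n) * rnorm x].

Section OperatorRoot.
Variables (X : E -> E) (XX : adj X X) (X1 : bdd 1 X).
Local Notation K := (osqrt1B X).

Lemma osqrt1B_approx n x :
  rnorm (x - root_iter X n x - K x) <= (1 - y n) * rnorm x.
Proof.
rewrite /osqrt1B; case: xgetP => [k _ /(_ n) //|noK].
have [l xl] := root_iter_lim XX X1 x; case: (noK (x - l)) => m.
have -> : x - root_iter X m x - (x - l) = l - root_iter X m x by zmod_eq.
by rewrite rdistC.
Qed.

Lemma osqrt1B_small (V : normedModType R[i]) (z : V) c :
  (forall n, rnorm z <= c * (1 - y n)) -> z = 0.
Proof.
move=> zc; apply: (@rnorm_small _ _ z `|c|) => e /root_iter1_cvg[n ne].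
rewrite (le_trans (zc n)) // (le_trans (ler_wpM2r _ (ler_norm c))) //.
  by rewrite subr_ge0; case/andP: (@root_iter1_01 R n).
by rewrite ler_wpM2l // ltW.
Qed.

Lemma osqrt1B_adj : adj K K.
Proof.
move=> u v; apply/eqP; rewrite -subr_eq0; apply/eqP.
apply: (@osqrt1B_small _ _ (8 * (rnorm u * rnorm v))) => n.
have -> : ip (K u) v - ip u (K v) = ip u (v - root_iter X n v - K v) -
    ip (u - root_iter X n u - K u) v.
  by rewrite !(ipBl, ipBr) (root_iter_adj n XX); zmod_eq.
have b1 := rnorm_ip_le u (v - root_iter X n v - K v).
have b2 := rnorm_ip_le (u - root_iter X n u - K u) v.
have b3 := ler_wpM2l (rnorm_ge0 u) (osqrt1B_approx n v).
have b4 := ler_wpM2l (rnorm_ge0 v) (osqrt1B_approx n u).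
rewrite (le_trans (rnormB _ _)) //.
by rewrite [X in _ <= 4 * X]mulrC in b2; lra.
Qed.

Lemma osqrt1B_dist x : rnorm (x - K x) <= rnorm x.
Proof.
by have := @osqrt1B_approx 0%N x; rewrite /= !subr0 mul1r.
Qed.

Lemma osqrt1B_comm T T' M : adj T T' -> 0 <= M -> bdd M T ->
  (forall x, T (X x) = X (T x)) -> forall x, T (K x) = K (T x).
Proof.
move=> TT' M0 TM TX x; apply/eqP; rewrite -subr_eq0; apply/eqP.
apply: (@osqrt1B_small _ _ (2 * M * rnorm x)) => n.
have -> : T (K x) - K (T x) = (T x - root_iter X n (T x) - K (T x)) -
    T (x - root_iter X n x - K x).
  by rewrite !(adjB TT') (root_iter_comm n TT' TX); zmod_eq.
have b1 := osqrt1B_approx n (T x).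
have b2 := TM (x - root_iter X n x - K x).
have b3 := ler_wpM2l M0 (osqrt1B_approx n x).
have y1 : 0 <= 1 - y n by rewrite subr_ge0; case/andP: (@root_iter1_01 R n).
have b4 := ler_wpM2l y1 (TM x).
by rewrite (le_trans (rnormB _ _)) //; lra.
Qed.

Lemma osqrt1B_sqr x : K (K x) = x - X x.
Proof.
apply/eqP; rewrite -subr_eq0; apply/eqP.
apply: (@osqrt1B_small _ _ (6 * rnorm x)) => n.
have Y1 := root_iter_bdd1 n X1.
have YB := adjB (root_iter_adj n XX).
have iterS : root_iter X n (root_iter X n x) =
    root_iter X n.+1 x + root_iter X n.+1 x - X x.
  by rewrite /= -scalerDr scale_half addrAC subrr add0r.
have b1 := osqrt1B_approx n.+1 x; have b2 := osqrt1B_approx n (K x).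
have b3 := osqrt1B_approx n x; have b4 := Y1 (x - root_iter X n x - K x).
have b5 := osqrt1B_dist x.
have b6 : y n <= y n.+1 by have := @root_iter1_le R n 1; rewrite add1n.
have b7 : y n.+1 <= 1 by case/andP: (@root_iter1_01 R n.+1).
(* The recursion [2 Y_{n+1} = X + Y_n^2] turns the defect into approximation errors, worth 1 + 1 + 2
   + 2 = 6 times [(1 - y n) * rnorm x]. *)
have -> : K (K x) - (x - X x) =
    ((x - root_iter X n x - K x) + root_iter X n (x - root_iter X n x - K x))
    - ((K x - root_iter X n (K x) - K (K x)) +
       ((x - root_iter X n.+1 x - K x) + (x - root_iter X n.+1 x - K x))).
  by rewrite !YB iterS; zmod_eq.
have tri (a b c d : E) : rnorm ((a + b) - (c + (d + d))) <=
    rnorm a + rnorm b + (rnorm c + (rnorm d + rnorm d)).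
  by rewrite (le_trans (rnormB _ _)) // lerD ?rnormD // (le_trans (rnormD _ _)) //
    lerD ?rnormD.
rewrite (le_trans (tri _ _ _ _)) //.
have b8 : rnorm (K x) <= 2 * rnorm x.
  by have := rdistD x (K x) 0; rewrite !subr0 rdistC; lra.
have b9 := ler_wpM2l (_ : 0 <= 1 - y n) b8.
have b10 := ler_wpM2r (rnorm_ge0 x) b6.
by move: b9; rewrite subr_ge0 (le_trans b6 b7) => /(_ isT); lra.
Qed.

End OperatorRoot.

Lemma osqrt1B_cont X Z d n : adj X X -> adj Z Z -> bdd 1 X -> bdd 1 Z -> 0 <= d ->
  (forall x, rnorm (X x - Z x) <= d * rnorm x) ->
  forall x, rnorm (osqrt1B X x - osqrt1B Z x) <=
    (2 * (1 - y n) + n%:R * d) * rnorm x.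
Proof.
move=> XX ZZ X1 Z1 d0 XZ x.
have -> : osqrt1B X x - osqrt1B Z x = - (x - root_iter X n x - osqrt1B X x) +
   (- (root_iter X n x - root_iter Z n x) + (x - root_iter Z n x - osqrt1B Z x)).
  by zmod_eq.
have b1 := osqrt1B_approx XX X1 n x; have b2 := osqrt1B_approx ZZ Z1 n x.
have b3 := root_iter_lip n XX X1 Z1 d0 XZ x.
rewrite (le_trans (rnormD _ _)) // rnormN.
have := rnormD (- (root_iter X n x - root_iter Z n x)) (x - root_iter Z n x - osqrt1B Z x).
by rewrite rnormN !mulrDl; lra.
Qed.

End SquareRoot.
(** * Positive operators *)

Section Positivity.
Context {R : realType} {A : cstarType R} {E : hilbertModType A}.
Implicit Types (S T h k : E -> E) (x : E).

(** In this form sums of positive operators are positive by the triangle inequality alone, and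
    [1 - T / M] is a contraction, as [osqrt1B] requires. *)
Definition pos T : Prop :=
  adj T T /\ exists2 M : R, 0 < M &
    forall x, rnorm (M%:C *: x - T x) <= M * rnorm x.

Lemma adj_add T T' S S' : adj T T' -> adj S S' ->
  adj (fun x => T x + S x) (fun x => T' x + S' x).
Proof. by move=> TT SS x y; rewrite ipD ipDr TT SS. Qed.

Lemma adj_scale T T' (a : R) : adj T T' ->
  adj (fun x => a%:C *: T x) (fun x => a%:C *: T' x).
Proof. by move=> TT x y; rewrite ipZ ipZCr TT. Qed.

Lemma adj_scaleB T (m : R) : adj T T ->
  adj (fun x => m%:C *: x - T x) (fun x => m%:C *: x - T x).
Proof. by move=> TT x y; rewrite ipBl ipBr ipZ ipZCr TT. Qed.

(* The operator h + ik is unitary and h is its real part. *)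
Lemma contr_of_sqr_sum h k : adj h h -> adj k k ->
  (forall x, h (k x) = k (h x)) -> (forall x, h (h x) + k (k x) = x) ->
  bdd 1 h.
Proof.
move=> hh kk hk hk1 x.
have iso (c : R[i]) : Num.conj c = - c -> c * c = -1 ->
    rnorm (h x + c *: k x) = rnorm x.
  move=> c1 c2; apply/eqP; rewrite -(eqrXn2 (n := 2)) ?rnorm_ge0 //.
  rewrite -!rnorm_ipxx ipxxD !ipZ !ipZr c1 scalerA mulrN c2 opprK scale1r.
  by rewrite scaleNr !hh !kk hk addNr addr0 -ipDr hk1.
have i2 : 'i * 'i = -1 :> R[i] by rewrite -expr2 sqr_i.
have := rnormD (h x + 'i *: k x) (h x + (- 'i) *: k x).
rewrite !iso ?conj_imag ?rmorphN ?mulrNN //; last by rewrite /= conj_imag.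
rewrite scaleNr addrACA subrr addr0 -[h x + h x](_ : (2 : R)%:C *: h x = _).
  by rewrite rnormZ_ge0 //; lra.
by rewrite rmorph_nat scaler_nat.
Qed.

Lemma contr_sqr h : adj h h -> bdd 1 h -> forall x, rnorm (x - h (h x)) <= rnorm x.
Proof.
move=> hh h1 x; have XX := adj_comp hh hh.
have X1 : bdd 1 (h \o h) by rewrite -[1](mulr1 1); apply: bdd_comp.
have KK := osqrt1B_adj XX X1; have K2 := osqrt1B_sqr XX X1.
have hK := osqrt1B_comm XX X1 hh ler01 h1 (fun=> erefl).
rewrite -[h (h x)]/((h \o h) x) -K2.
have K1 : bdd 1 (osqrt1B (h \o h)).
  by apply: (contr_of_sqr_sum KK hh) => y; rewrite ?hK ?K2 /= ?subrK.
by rewrite (le_trans (K1 _)) // mul1r (le_trans (K1 _)) // mul1r.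
Qed.

Lemma sqr_dist T M : 0 < M -> adj T T -> bdd M T ->
  forall x, rnorm ((M ^+ 2)%:C *: x - T (T x)) <= M ^+ 2 * rnorm x.
Proof.
move=> M0 TT TM x; have M0' := ltW M0; pose h z := (M^-1)%:C *: T z.
have hh : adj h h := adj_scale _ TT.
have h1 : bdd 1 h.
  move=> z; rewrite /h rnormZ_ge0 ?invr_ge0 // mul1r.
  by rewrite ler_pdivrMl.
have /(ler_wpM2l (ltW (exprn_gt0 2 M0))) := contr_sqr hh h1 x.
rewrite -rnormZ_ge0 ?exprn_ge0 // scalerBr /h (adjZ TT) !scalerA -!rmorphM /=.
by rewrite expr2 !mulfK ?gt_eqF // mulfV ?gt_eqF // scale1r.
Qed.

Lemma pos_sqr T M : adj T T -> bdd M T -> pos (T \o T).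
Proof.
move=> TT TM; split; first exact: adj_comp.
have M0 : 0 < `|M| + 1 by rewrite ltr_wpDl.
exists ((`|M| + 1) ^+ 2); first by rewrite exprn_gt0.
apply: sqr_dist => //; apply: bdd_le TM.
by rewrite (le_trans (ler_norm M)) // lerDl.
Qed.

Lemma posD T S : pos T -> pos S -> pos (fun x => T x + S x).
Proof.
move=> [TT [M M0 TM]] [SS [N N0 SN]]; split; first exact: adj_add.
exists (M + N) => [|x]; first exact: addr_gt0.
rewrite rmorphD /= scalerDl opprD addrACA mulrDl.
by rewrite (le_trans (rnormD _ _)) // lerD.
Qed.

Lemma posZ T a : 0 < a -> pos T -> pos (fun x => a%:C *: T x).
Proof.
move=> a0 [TT [M M0 TM]]; have a0' := ltW a0; split; first exact: adj_scale.
exists (a * M) => [|x]; first exact: mulr_gt0.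
by rewrite rmorphM /= -scalerA -scalerBr rnormZ_ge0 // -mulrA ler_wpM2l.
Qed.

Lemma pos_scaleB T m : 0 < m -> adj T T -> bdd m T ->
  pos (fun x => m%:C *: x - T x).
Proof.
move=> m0 TT Tm; split; first exact: adj_scaleB.
by exists m => // x; rewrite opprB addrC subrK.
Qed.

Lemma pos_bdd T : pos T -> exists2 M, 0 < M & bdd M T.
Proof.
move=> [_ [M M0 TM]]; have M0' := ltW M0; exists (2 * M) => [|x]; first by rewrite mulr_gt0.
have := rdistD (M%:C *: x) (T x) 0; rewrite !subr0 rdistC.
by rewrite rnormZ_ge0 //; have := TM x; lra.
Qed.

(** Since [T = M (1 - X)] with [X] a contraction, the root is [sqrt M] times that of [1 - X]. Being
    a limit of polynomials in [T], it inherits the commutation relations of [T]. *)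
Lemma pos_root T : pos T -> exists K, [/\ pos K, forall x, K (K x) = T x &
  forall S S' N, adj S S' -> 0 <= N -> bdd N S ->
    (forall x, S (T x) = T (S x)) -> forall x, S (K x) = K (S x)].
Proof.
move=> [TT [M M0 TM]]; have M0' := ltW M0; pose X x := x - (M^-1)%:C *: T x.
have XX : adj X X by move=> u v; rewrite /X ipBl ipBr ipZ ipZCr TT.
have MX x : M%:C *: X x = M%:C *: x - T x.
  by rewrite /X scalerBr scalerA -rmorphM /= mulfV ?gt_eqF // scale1r.
have X1 : bdd 1 X.
  move=> x; rewrite -(ler_pM2l M0) mul1r -rnormZ_ge0 // MX.
  exact: TM.
have KK := osqrt1B_adj XX X1; have s0 : 0 < Num.sqrt M by rewrite sqrtr_gt0.
have s0' := ltW s0.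
exists (fun x => (Num.sqrt M)%:C *: osqrt1B X x); split.
- split; first exact: adj_scale.
  exists (Num.sqrt M) => // x; rewrite -scalerBr rnormZ_ge0 //.
  by rewrite ler_pM2l // osqrt1B_dist.
- move=> x; rewrite (adjZ KK) scalerA -rmorphM /= -expr2 sqr_sqrtr //.
  by rewrite (osqrt1B_sqr XX X1) scalerBr MX opprB addrC subrK.
- move=> S S' N SS N0 SN ST x; rewrite (adjZ SS); congr (_ *: _).
  apply: (osqrt1B_comm XX X1 SS N0 SN) => z.
  by rewrite /X (adjB SS) (adjZ SS) ST.
Qed.

Lemma bdd_of_sqr_sum h k m : 0 < m -> adj h h -> adj k k ->
  (forall x, h (k x) = k (h x)) ->
  (forall x, h (h x) + k (k x) = m%:C *: x) ->
  forall x, rnorm (h (h x)) <= m * rnorm x.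
Proof.
move=> m0 hh kk hk hkm x; have m0' := ltW m0.
have s0 : 0 < Num.sqrt m by rewrite sqrtr_gt0.
have s0' := ltW s0.
have ss : (Num.sqrt m)^-1 * (Num.sqrt m)^-1 = m^-1.
  by rewrite -invfM -expr2 sqr_sqrtr.
pose g h x := ((Num.sqrt m)^-1)%:C *: h x : E.
have gb : bdd 1 (g h).
  apply: (@contr_of_sqr_sum _ (g k)); rewrite /g; do ?exact: adj_scale.
    by move=> z; rewrite (adjZ hh) (adjZ kk) hk.
  move=> z; rewrite (adjZ hh) (adjZ kk) !scalerA -!rmorphM /= ss -scalerDr hkm.
  by rewrite scalerA -rmorphM /= mulVf ?gt_eqF // scale1r.
have hb z : rnorm (h z) <= Num.sqrt m * rnorm z.
  have := gb z; rewrite /g rnormZ_ge0 ?invr_ge0 // mul1r.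
  by rewrite ler_pdivrMl.
rewrite (le_trans (hb _)) // (le_trans (ler_wpM2l (ltW s0) (hb _))) //.
by rewrite mulrA -expr2 sqr_sqrtr.
Qed.

(** [m - T = (m - (T + S)) + S] is a sum of positive operators. The roots of [T] and of [m - T]
    commute and their squares add up to [m], so the unitary argument bounds both squares by [m]. *)
Lemma pos_add_le T S m : 0 < m -> pos T -> pos S ->
  bdd m (fun x => T x + S x) ->
  bdd m T /\ forall x, rnorm (m%:C *: x - T x) <= m * rnorm x.
Proof.
move=> m0 pT pS TSm; pose P x := m%:C *: x - T x.
have [TT _] := pT.
have pP : pos P.
  have -> : P = fun x => (m%:C *: x - (T x + S x)) + S x.
    by apply: funext => x; rewrite /P; zmod_eq.
  apply: (posD _ pS); apply: pos_scaleB => //.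
  by case: pS => SS _; exact: adj_add.
have [l [pl ll lc]] := pos_root pT; have [n [pn nn nc]] := pos_root pP.
have [L L0 lL] := pos_bdd pl; have [lA _] := pl; have [nA _] := pn.
have ln x : l (n x) = n (l x).
  apply: (nc l l L lA (ltW L0) lL) => z.
  by rewrite /P (adjB lA) (adjZ lA) -!ll.
have sum x : l (l x) + n (n x) = m%:C *: x by rewrite ll nn /P addrC subrK.
split=> x; first by rewrite -ll; exact: (bdd_of_sqr_sum m0 lA nA).
rewrite -/(P x) -nn; apply: (bdd_of_sqr_sum m0 nA lA) => // z.
by rewrite addrC.
Qed.

(** The constant witnessing [pos] can be replaced by any bound of [T]: this is [pos_add_le] with
    [S = 0]. *)
Lemma pos_dist T m : 0 < m -> pos T -> bdd m T ->
  forall x, rnorm (m%:C *: x - T x) <= m * rnorm x.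
Proof.
move=> m0 pT Tm; have p0 : pos (fun=> 0 : E).
  split=> [x y|]; first by rewrite ip0l ip0r.
  by exists 1 => // x; rewrite subr0 scale1r mul1r.
apply: (proj2 (pos_add_le m0 pT p0 _)) => x.
by rewrite addr0.
Qed.

End Positivity.

(** * Positivity of the product of an operator with its adjoint *)

Section PositiveProducts.
Context {R : realType} {A : cstarType R} {E : hilbertModType A}.
(** Discharged below for [A] acting on itself. The constant matters: with the 4 of [rnorm_ip_le] the
    halving argument would gain nothing. *)
Hypothesis cauchy_schwarz : forall x y : E, rnorm (ip x y) <= rnorm x * rnorm y.
Implicit Types (B C D : E -> E) (x : E).

(* If -CC' is positive then so is Q = C'C, since CC' + C'C is a sum of squares
   of self-adjoint operators; D = -CC' then satisfies (2m + Q)C' = C'(2m - D),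
   whence |D| <= m implies |D| <= m / 2. *)
Lemma neg_mul_adj_halve C C' M m : adj C C' -> 0 <= M -> bdd M C ->
  pos (fun x => - C (C' x)) -> 0 < m ->
  bdd m (fun x => - C (C' x)) -> bdd (m / 2) (fun x => - C (C' x)).
Proof.
move=> CC M0 CM pD m0; have CC' := adj_sym CC; have m0' := ltW m0.
set D := (D in pos D) in pD * => Dm.
have C'M := adj_bdd CC M0 CM.
(* Up to factors 2 and -2, the real and imaginary parts of [C]; they satisfy
   [a^2 + b^2 = 2 (C C' + C' C)]. *)
pose a x := C x + C' x; pose b x := 'i *: (C x - C' x).
have aa : adj a a by move=> x y; rewrite /a ipD ipDr CC CC' addrC.
have bb : adj b b.
  move=> x y; rewrite /b ipZ ipZr conj_imag scaleNr -scalerN; congr (_ *: _).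
  by rewrite ipBl ipBr CC CC' opprB.
have aM : bdd (M + 4 * M) a.
  by move=> x; rewrite (le_trans (rnormD _ _)) // mulrDl lerD.
have bM : bdd (M + 4 * M) b.
  by move=> x; rewrite rnormiZ (le_trans (rnormB _ _)) // mulrDl lerD.
have pQ : pos (C' \o C).
  have -> : C' \o C = fun x => (2^-1 : R)%:C *: ((D x + D x) + (a (a x) + b (b x))).
    apply: funext => x; rewrite /b (adjZ CC) (adjZ CC') -scalerBr scalerA.
    rewrite -expr2 sqr_i scaleN1r /a !(adjD CC, adjD CC', adjN CC, adjN CC') /D.
    have -> : forall s t u v : E, - t + - t + (u + t + (s + v) - (u - t - (s - v)))
       = s + s by move=> s t u v; zmod_eq.
    by rewrite scale_half.
  have h0 : 0 < 2^-1 :> R by rewrite invr_gt0.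
  apply: (posZ h0); apply: posD; first exact: posD.
  by apply: posD; [exact: pos_sqr aM | exact: pos_sqr bM].
have lower y : 2 * m * rnorm y <= rnorm ((2 * m)%:C *: y + C' (C y)).
  have [_ [N N0 QN]] := pQ.
  have := rnormB ((2 * m)%:C *: y + C' (C y)) (- (N%:C *: y - C' (C y))).
  have -> : (2 * m)%:C *: y + C' (C y) - - (N%:C *: y - C' (C y)) =
      (2 * m + N)%:C *: y.
    by rewrite [RHS]scaleCD; zmod_eq.
  have m2N : 0 <= 2 * m + N by rewrite addr_ge0 ?mulr_ge0 // ltW.
  rewrite rnormN rnormZ_ge0 // mulrDl => /le_trans/(_ (lerD (lexx _) (QN y))).
  by rewrite lerD2r.
have [DD _] := pD; have Dd := pos_dist m0 pD Dm.
(* With [z = (2 m - D) x] the chain is [4 m^2 |C' x|^2 <= |C' z|^2 <= |D z| |z| <= 2 m^3 |x|^2]. *)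
have C'2 x : rnorm (C' x) ^+ 2 <= m / 2 * rnorm x ^+ 2.
  pose z := (2 * m)%:C *: x - D x.
  have C'z : (2 * m)%:C *: C' x + C' (C (C' x)) = C' z.
    by rewrite /z (adjB CC') (adjZ CC') /D (adjN CC') opprK.
  have z1 : rnorm z <= 2 * m * rnorm x.
    have := rnormD (m%:C *: x) (m%:C *: x - D x); rewrite rnormZ_ge0 //.
    rewrite addrA -scaleCD -mulr2n -[m *+ 2]mulr_natl -/z.
    by have := Dd x; lra.
  have z2 : rnorm (D z) <= m ^+ 2 * rnorm x.
    (* [D (2 m - D) = m^2 - (m - D)^2], where [m - D] is self-adjoint and bounded by [m]. *)
    have -> : D z = (m ^+ 2)%:C *: x - (m%:C *: (m%:C *: x - D x) - D (m%:C *: x - D x)).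
      rewrite /z !(adjB DD) !(adjZ DD) scalerBr !scaleCC expr2.
      have -> : (2 * m)%:C *: D x = m%:C *: D x + m%:C *: D x.
        by rewrite -scaleCD -mulr2n -[m *+ 2]mulr_natl.
      by zmod_eq.
    exact: (sqr_dist m0 (adj_scaleB m DD) Dd).
  have e1 : rnorm (C' z) ^+ 2 <= rnorm (D z) * rnorm z.
    rewrite -rnorm_ipxx CC' -rnormN -ipNr -/(D z) mulrC.
    exact: cauchy_schwarz.
  have l1 := lower (C' x); rewrite C'z in l1.
  have l2 : (2 * m * rnorm (C' x)) ^+ 2 <= rnorm (C' z) ^+ 2.
    by rewrite ler_sqr ?nnegrE ?mulr_ge0 ?rnorm_ge0.
  have l3 := ler_pM (rnorm_ge0 _) (rnorm_ge0 _) z2 z1.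
  have m2 : 0 < 4 * m ^+ 2 by rewrite mulr_gt0 ?exprn_gt0.
  rewrite -(ler_pM2l m2).
  have -> : 4 * m ^+ 2 * (m / 2 * rnorm x ^+ 2) = m ^+ 2 * rnorm x * (2 * m * rnorm x).
    by field.
  apply: le_trans l3; apply: le_trans e1; apply: le_trans l2.
  by rewrite le_eqVlt; apply/orP; left; apply/eqP; ring.
have s2 : Num.sqrt (m / 2) ^+ 2 = m / 2 by rewrite sqr_sqrtr // divr_ge0.
have C'b : bdd (Num.sqrt (m / 2)) C'.
  move=> x; rewrite -ler_sqr ?nnegrE ?mulr_ge0 ?rnorm_ge0 ?sqrtr_ge0 //.
  by rewrite exprMn s2.
have Cb : bdd (Num.sqrt (m / 2)) C.
  move=> x; have [->|C0] := eqVneq (rnorm (C x)) 0.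
    by rewrite mulr_ge0 ?sqrtr_ge0 ?rnorm_ge0.
  have Cx0 : 0 < rnorm (C x) by rewrite lt_neqAle eq_sym C0 rnorm_ge0.
  rewrite -(ler_pM2r Cx0) -expr2 -rnorm_ipxx CC.
  rewrite (le_trans (cauchy_schwarz _ _)) // -mulrA [leRHS]mulrCA.
  by rewrite ler_wpM2l ?rnorm_ge0.
move=> x; rewrite rnormN (le_trans (Cb _)) // -[in leRHS]s2 expr2 -mulrA.
by rewrite ler_wpM2l ?sqrtr_ge0.
Qed.

Lemma neg_mul_adj_eq0 C C' M : adj C C' -> 0 <= M -> bdd M C ->
  pos (fun x => - C (C' x)) -> forall x, C (C' x) = 0.
Proof.
move=> CC M0 CM pD x; have [m m0 Dm] := pos_bdd pD.
have step n : bdd (m / 2 ^+ n) (fun x => - C (C' x)).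
  elim: n => [|n IH]; first by rewrite expr0 divr1.
  rewrite exprSr invfM mulrA; apply: (neg_mul_adj_halve CC M0 CM pD) => //.
  by rewrite divr_gt0 ?exprn_gt0.
apply: (@rnorm_small _ _ _ (m * rnorm x)) => e e0.
have := archi_boundP (ltW (_ : 0 < e^-1)); rewrite invr_gt0 => /(_ e0).
set n := Num.Def.archi_bound _ => en.
have := step n x; rewrite rnormN => /le_trans; apply.
rewrite mulrAC ler_wpM2l ?mulr_ge0 ?rnorm_ge0 ?(ltW m0) //.
rewrite -[e]invrK lef_pV2 ?posrE ?invr_gt0 ?exprn_gt0 //.
rewrite (le_trans (ltW en)) // -natrX ler_nat.
by rewrite ltnW // ltn_expl.
Qed.

(** [N] is the absolute value of [H = B B'], and [K = N - H] is twice the negative part of [H]. As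
    [H K = - N K], the operator [C = K B] has [- C C' = K N K], which is the square of [L = G K]
    with [G] the root of [N]. So [C C'] vanishes by [neg_mul_adj_eq0], and with it [L], then [N K]
    and [H K], and finally [K]. *)
Lemma pos_mul_adj B B' M : adj B B' -> 0 <= M -> bdd M B -> pos (B \o B').
Proof.
move=> BB M0 BM; have BB' := adj_sym BB.
have B'M := adj_bdd BB M0 BM; set H := B \o B'.
have HH : adj H H := adj_comp BB' BB.
have H0 : 0 <= M * (4 * M) by rewrite !mulr_ge0.
have HM : bdd (M * (4 * M)) H by apply: bdd_comp.
have [N [pN NN NC]] := pos_root (pos_sqr HH HM).
have [NA _] := pN.
have HN x : H (N x) = N (H x) by apply: (NC _ _ _ HH H0 HM).
have [G [pG GG GC]] := pos_root pN; have [GA _] := pG.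
have [N1 N10 NN1] := pos_bdd pN; have [G1 G10 GG1] := pos_bdd pG.
pose K x := N x - H x.
have KA : adj K K by move=> x y; rewrite /K ipBl ipBr NA HH.
have KM : bdd (N1 + M * (4 * M)) K.
  by move=> x; rewrite (le_trans (rnormB _ _)) // mulrDl lerD.
have K0 : 0 <= N1 + M * (4 * M) by rewrite addr_ge0 // ltW.
have KG x : K (G x) = G (K x).
  by apply: (GC _ _ _ KA K0 KM) => z; rewrite /K (adjB NA) HN.
have HK x : H (K x) = - N (K x).
  by rewrite /K (adjB HH) (adjB NA) HN -[H (H x)]NN opprB.
pose L := G \o K.
have LA : adj L L.
  by move=> x y; rewrite /L /= GA KA -KG.
have LL : L \o L = fun x => - (K \o B) ((B' \o K) x).
  apply: funext => x; rewrite /L /= -[B (B' _)]/(H (K x)) HK (adjN KA) opprK.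
  by rewrite -KG GG.
have pL : pos (L \o L).
  by apply: (@pos_sqr _ _ _ _ (G1 * (N1 + M * (4 * M)))) => //; apply: bdd_comp (ltW G10) KM GG1.
have KB0 : 0 <= (N1 + M * (4 * M)) * M by rewrite mulr_ge0.
have KB := bdd_comp K0 BM KM.
have LL0 := neg_mul_adj_eq0 (adj_comp BB KA) KB0 KB.
rewrite -LL in LL0; have {}LL0 x := LL0 pL x.
have L0 x : L x = 0.
  apply: ipxx_eq0; rewrite LA.
  by rewrite -[L (L x)]/((L \o L) x) LL LL0 oppr0 ip0r.
suff -> : H = N by [].
apply: funext => x; apply/eqP; rewrite eq_sym -subr_eq0 -/(K x); apply/eqP/ipxx_eq0.
have GK : N (K x) = 0 by rewrite -GG -[G (K x)]/(L x) L0 (adj0 GA).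
by rewrite KA {1}/K GK HK GK oppr0 subr0 ip0r.
Qed.

End PositiveProducts.
(** * Positive elements *)

(* A as a Hilbert module over itself, with inner product x y^*. *)
Definition cself (R : realType) (A : cstarType R) : Type := A.

Section SelfModule.
Context {R : realType} {A : cstarType R}.

HB.instance Definition _ := CompleteNormedModule.on (cself A).

Let self_ip (x y : cself A) : A := cmul x (cstar y).

Fact self_ip_star x y : cstar (self_ip x y) = self_ip y x.
Proof. by rewrite /self_ip cstarM cstarK. Qed.

Fact self_ip_ge0 x : exists b, self_ip x x = cmul (cstar b) b.
Proof. by exists (cstar x); rewrite cstarK. Qed.

Fact self_ip_norm (x : cself A) : `|x| ^+ 2 = `|self_ip x x|.
Proof.
have := rnorm_cstar_cmul (cstar (x : A)); rewrite cstarK rnorm_cstar => xx.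
by rewrite /self_ip -[in RHS]rnormE xx rmorphXn /= rnormE.
Qed.

HB.instance Definition _ := isHilbertModule.Build R A (cself A)
  (fun a b c => esym (cmulA a b c))
  (fun a b x => cmulDl a b x) (fun a x y => cmulDr a x y)
  (fun k a x => cmulZl k a x) (fun k a x => cmulZr k a x)
  (fun x y z : cself A => cmulDl x y (cstar z))
  (fun k (x y : cself A) => cmulZl k x (cstar y))
  (fun a x y : cself A => esym (cmulA a x (cstar y)))
  self_ip_star self_ip_ge0 self_ip_norm.

End SelfModule.

Section PositiveElements.
Context {R : realType} {A : cstarType R}.
Implicit Types a b : A.

Definition rmul b (x : cself A) : cself A := cmul (x : A) b.

Lemma rmul_adj b : adj (rmul b) (rmul (cstar b)).
Proof.
move=> x y; rewrite -[LHS]/(cmul (cmul x b) (cstar (y : A))).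
rewrite -[RHS]/(cmul x (cstar (cmul (y : A) (cstar b)))).
by rewrite cstarM cstarK cmulA.
Qed.

Lemma rmul_bdd b : bdd (rnorm b) (rmul b).
Proof. by move=> x; rewrite mulrC; exact: rnorm_cmul. Qed.

Definition apos a : Prop := pos (rmul a).

Lemma apos_sqr b : apos (cmul (cstar b) b).
Proof.
rewrite /apos; have -> : rmul (cmul (cstar b) b) = rmul b \o rmul (cstar b).
  by apply: funext => x; exact: cmulA.
apply: (pos_mul_adj _ (rmul_adj b) (rnorm_ge0 b) (rmul_bdd b)) => x y.
by rewrite -[rnorm (y : A)]rnorm_cstar; exact: rnorm_cmul.
Qed.

Lemma aposD a b : apos a -> apos b -> apos (a + b).
Proof.
rewrite /apos => pa pb; have -> : rmul (a + b) = fun x => rmul a x + rmul b x.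
  by apply: funext => x; exact: cmulDr.
exact: posD.
Qed.

(** The norm of [a] is read off from [rmul a] at [cstar a], by the C*-identity. The extra [e] makes
    the constant passed to [pos_add_le] strictly positive. *)
Lemma apos_le a b : apos a -> apos b -> rnorm a <= rnorm (a + b).
Proof.
move=> pa pb; apply/ler_addgt0Pr => e e0.
have m0 : 0 < rnorm (a + b) + e by rewrite ltr_wpDl ?rnorm_ge0.
have [|aT _] := pos_add_le m0 pa pb.
  move=> x; rewrite -[_ + _ in X in X <= _]/(cmul (x : A) a + cmul (x : A) b).
  rewrite -cmulDr (le_trans (rnorm_cmul _ _)) // mulrC ler_wpM2r ?rnorm_ge0 //.
  by rewrite lerDl ltW.
have [a0|a0] := eqVneq (rnorm a) 0; first by rewrite a0 ltW.
have ra : 0 < rnorm a by rewrite lt_neqAle eq_sym a0 rnorm_ge0.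
have := aT (cstar a : cself A); rewrite rnorm_cstar_cmul.
by rewrite [rnorm (cstar a : A)]rnorm_cstar expr2 ler_pM2r.
Qed.

End PositiveElements.

Section IpPositive.
Context {R : realType} {A : cstarType R}.
Implicit Types E F : hilbertModType A.

Lemma apos_ip E (x : E) : apos (ip x x).
Proof. by have [b ->] := ip_ge0 x; exact: apos_sqr. Qed.

Lemma rnorm_ip_addl E F (x : E) (y : F) :
  rnorm x ^+ 2 <= rnorm (ip x x + ip y y).
Proof. by rewrite -rnorm_ipxx; apply: apos_le; exact: apos_ip. Qed.

Lemma rnorm_ip_addr E F (x : E) (y : F) :
  rnorm y ^+ 2 <= rnorm (ip x x + ip y y).
Proof. by rewrite addrC rnorm_ip_addl. Qed.

End IpPositive.

(** * Regular operators *)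

Lemma invS_lt (R : realType) (e : R) : 0 < e ->
  exists N, forall n, (N <= n)%N -> n.+1%:R^-1 < e.
Proof.
move=> e0; have := archi_boundP (ltW (_ : 0 < e^-1)); rewrite invr_gt0 => /(_ e0).
set N := Num.Def.archi_bound _ => eN; exists N => n Nn.
rewrite -[e]invrK ltf_pV2 ?posrE ?invr_gt0 ?ltr0n //.
by rewrite (lt_le_trans eN) // ler_nat (leq_trans Nn).
Qed.

(* Extension by continuity of a bounded linear relation r, whose values are
   pairs in V * W. *)
Lemma extend_dense (R : realType) (U : normedModType R[i])
    (V W : completeNormedModType R[i]) (r : U -> V -> W -> Prop) (C : R) :
  (forall x y z x' y' z', r x y z -> r x' y' z' -> r (x - x') (y - y') (z - z')) ->
  (forall x y z, r x y z -> rnorm y <= C * rnorm x /\ rnorm z <= C * rnorm x) ->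
  0 <= C ->
  (forall x (e : R), 0 < e -> exists x' y' z', r x' y' z' /\ rnorm (x - x') < e) ->
  forall x, exists y z, forall e : R, 0 < e -> exists x' y' z',
    [/\ r x' y' z', rnorm (x - x') < e, rnorm (y - y') < e & rnorm (z - z') < e].
Proof.
move=> rB rC C0 rD x.
have /choice[f fP] n : exists p : U * V * W,
    r p.1.1 p.1.2 p.2 /\ rnorm (x - p.1.1) < n.+1%:R^-1 :> R.
  have [|x' [y' [z' ?]]] := rD x (n.+1%:R^-1); first by rewrite invr_gt0 ltr0n.
  by exists (x', y', z').
have C1 : 0 < C + 1 by rewrite ltr_wpDl.
have cauchy (e : R) : 0 < e -> exists N, forall n m, (N <= n)%N -> (N <= m)%N ->
    rnorm ((f n).1.2 - (f m).1.2) < e /\ rnorm ((f n).2 - (f m).2) < e.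
  move=> e0; have e1 : 0 < e / (C + 1) / 2 by rewrite !divr_gt0.
  have [N Ne] := invS_lt e1.
  exists N => n m /Ne nN /Ne mN; have [fn xn] := fP n; have [fm xm] := fP m.
  have [b1 b2] := rC _ _ _ (rB _ _ _ _ _ _ fn fm).
  have : rnorm ((f n).1.1 - (f m).1.1) <= e / (C + 1).
    have := rdistD x (f n).1.1 (f m).1.1; rewrite [rnorm (_ - x)]rdistC.
    by have := lt_trans xn nN; have := lt_trans xm mN; lra.
  move=> /(ler_wpM2l C0) b3.
  have b4 : C * (e / (C + 1)) < e.
    by rewrite mulrCA gtr_pMr // ltr_pdivrMr // mul1r ltrDl.
  by split; apply: le_lt_trans b4; apply: le_trans b3.
have [e e0|y yP] := @complete_rnorm _ _ (fun n => (f n).1.2).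
  by have [N Ne] := cauchy e e0; exists N => n m /Ne nN /nN [].
have [e e0|z zP] := @complete_rnorm _ _ (fun n => (f n).2).
  by have [N Ne] := cauchy e e0; exists N => n m /Ne nN /nN [].
exists y, z => e e0; have [N1 h1] := yP e e0; have [N2 h2] := zP e e0.
have [N3 h3] := invS_lt e0; pose n := maxn N1 (maxn N2 N3).
exists (f n).1.1, (f n).1.2, (f n).2; have [fn xn] := fP n; split=> //.
- by apply: lt_trans xn (h3 _ _); rewrite !leq_max leqnn !orbT.
- by apply: h1; rewrite leq_max leqnn.
- by apply: h2; rewrite !leq_max leqnn !orbT.
Qed.

Section Regular.
Context {R : realType} {A : cstarType R} {E F : hilbertModType A}.
Variable t : set (E * F).
Hypothesis t_reg : regular t.

Lemma graph_fun x y y' : t (x, y) -> t (x, y') -> y = y'.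
Proof. by case: t_reg => -[h _ _ _ _] _ _ _ _; apply: h. Qed.

Lemma graphB x y x' y' : t (x, y) -> t (x', y') -> t (x - x', y - y').
Proof.
case: t_reg => -[_ _ tD tZ _] _ _ _ _ xy x'y'.
by rewrite -[- x']scaleN1r -[- y']scaleN1r; apply: tD => //; apply: tZ.
Qed.

Lemma adjointB y z y' z' : adjoint t (y, z) -> adjoint t (y', z') ->
  adjoint t (y - y', z - z').
Proof. by move=> yz yz' x w xw /=; rewrite !ipBr (yz _ _ xw) (yz' _ _ xw). Qed.

Lemma adjoint_closed y z :
  (forall e : R, 0 < e -> exists y' z',
    [/\ adjoint t (y', z'), rnorm (y - y') < e & rnorm (z - z') < e]) ->
  adjoint t (y, z).
Proof.
move=> yz x w xw /=; apply/eqP; rewrite -subr_eq0; apply/eqP.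
apply: (@rnorm_small _ _ _ (4 * rnorm w + 4 * rnorm x)) => e /yz[y' [z' [a' y'e z'e]]].
have -> : ip w y - ip x z = ip w (y - y') - ip x (z - z').
  by rewrite !ipBr (a' _ _ xw); zmod_eq.
rewrite (le_trans (rnormB _ _)) // mulrDl -!mulrA.
by rewrite lerD // (le_trans (rnorm_ip_le _ _)) // ler_pM2l // ler_wpM2l ?rnorm_ge0 // ltW.
Qed.

(* u = (1 + t^* t)^{-1} v and y = t u *)
Definition resolves u y v := t (u, y) /\ adjoint t (y, v - u).

Lemma graph_ip x w u y v : t (x, w) -> resolves u y v ->
  ip x v = ip x u + ip w y.
Proof. by move=> xw [_ /(_ _ _ xw) /= ->]; rewrite ipBr addrC subrK. Qed.

Lemma resolvesB u y v u' y' v' : resolves u y v -> resolves u' y' v' ->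
  resolves (u - u') (y - y') (v - v').
Proof.
move=> [uy yv] [uy' yv']; split; first exact: graphB.
by have := adjointB yv yv'; congr (adjoint t (_, _)); zmod_eq.
Qed.

(** The cross terms of [v = u + (v - u)] both equal [ip y y]. All summands are positive, so [v]
    dominates [u], [y] and [v - u] at once. *)
Lemma resolves_ip u y v : resolves u y v ->
  ip v v = (ip u u + ip y y) + (ip y y + ip (v - u) (v - u)).
Proof.
move=> uyv; have uv := graph_ip uyv.1 uyv; have uz := uyv.2 _ _ uyv.1.
rewrite /= in uz; have zu : ip (v - u) u = ip y y by rewrite -ip_star -uz ip_star.
by rewrite -{1 2}[v](subrK u) ipxxD -uz zu; zmod_eq.
Qed.

Lemma resolves_le u y v : resolves u y v ->
  [/\ rnorm u <= rnorm v, rnorm y <= rnorm v & rnorm (v - u) <= rnorm v].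
Proof.
move=> /resolves_ip uyv; have pu := apos_ip u; have py := apos_ip y.
have pz := apos_ip (v - u).
have sq (V : hilbertModType A) (x : V) : rnorm (ip x x) <= rnorm (ip v v) ->
    rnorm x <= rnorm v.
  by rewrite !rnorm_ipxx ler_sqr ?nnegrE ?rnorm_ge0.
split; apply: sq; rewrite uyv.
- by rewrite -addrA; apply: apos_le => //; apply: aposD => //; apply: aposD.
- by rewrite [ip u u + _]addrC -addrA; apply: apos_le => //; apply: aposD => //; apply: aposD.
- rewrite addrA addrC; apply: apos_le => //.
  by apply: aposD => //; apply: aposD.
Qed.

Lemma resolves_uniq u y u' y' v :
  resolves u y v -> resolves u' y' v -> u = u' /\ y = y'.
Proof.
move=> r r'; have [] := resolves_le (resolvesB r r'); rewrite subrr rnorm0.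
by move=> /rnorm_le0/eqP + /rnorm_le0/eqP + _; rewrite !subr_eq0 => /eqP + /eqP.
Qed.

(** Regularity makes the range of [1 + t^* t] dense. It is everything because the bounds of
    [resolves_le] turn convergence of [v] into convergence of [u] and [y], and both [t] and its
    adjoint are closed. *)
Lemma resolvent_exists v : exists u y, resolves u y v.
Proof.
case: t_reg => _ t_cl _ _ t_ran.
have [||//||u [y uy]] := @extend_dense R E E F (fun v u y => resolves u y v) 1 _ _ _ _ v.
- by move=> *; exact: resolvesB.
- by move=> ? ? ? /resolves_le[? ? _]; rewrite mul1r.
- move=> x e /(dense_rnorm x t_ran)[w [u [y [z [uy yz /= ->]]]] xw].
  by exists (u + z), u, y; split=> //; split=> //; rewrite addrAC subrr add0r.
exists u, y; split.
  apply: (closed_prod_rnorm t_cl) => e /uy[v' [u' [y' [[uy' _] _ uu yy]]]].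
  by exists u', y'.
apply: adjoint_closed => e e0; have e2 : 0 < e / 2 by rewrite divr_gt0.
have [v' [u' [y' [[_ yz'] vv uu yy]]]] := uy _ e2.
exists y', (v' - u'); split=> //; first by lra.
have -> : v - u - (v' - u') = (v - v') - (u - u') by zmod_eq.
by have := rnormB (v - v') (u - u'); lra.
Qed.

End Regular.

(** * Resolvent and inverse square root of a regular operator *)

Lemma pos_positive_op (R : realType) (A : cstarType R) (E : hilbertModType A)
    (K : E -> E) : pos K -> positive_op K.
Proof.
move=> /pos_root[G [pG GG _]]; have [M M0 GM] := pos_bdd pG.
exists G, G; split; last by apply: funext => x; rewrite /= GG.
split; last by case: pG.
by exists M%:C => x; rewrite -!rnormE -rmorphM lecR.
Qed.

(* With D = S - K we have (S + K) D = S^2 - K^2 = 0, and positivity of both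
   terms gives S D = K D = 0, so D^2 = 0. *)
Lemma positive_root_uniq (R : realType) (A : cstarType R) (E : hilbertModType A)
    (S K : E -> E) : positive_op S -> positive_op K ->
  (forall x, S (K x) = K (S x)) -> (forall x, S (S x) = K (K x)) -> S = K.
Proof.
have sym (T B B' : E -> E) : adj B B' -> T = B' \o B -> adj T T.
  by move=> BB ->; exact: (adj_comp BB (adj_sym BB)).
move=> [B [B' [[_ BB] SE]]] [G [G' [[_ GG] KE]]] SK SSKK.
have SA := sym _ _ _ BB SE; have KA := sym _ _ _ GG KE.
apply: funext => x; set w := S x - K x.
have Sw : S w + K w = 0 by rewrite /w (adjB SA) (adjB KA) SK SSKK; zmod_eq.
have BG : ip (B w) (B w) + ip (G w) (G w) = 0.
  rewrite BB GG -[B' _]/((B' \o B) w) -[G' _]/((G' \o G) w) -SE -KE.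
  by rewrite -ipDr Sw ip0r.
have := rnorm_ip_addl (B w) (G w); have := rnorm_ip_addr (B w) (G w).
rewrite BG rnorm0 => G0 B0.
have zero (z : E) : rnorm z ^+ 2 <= 0 -> z = 0.
  move=> z0; apply: rnorm_eq0; apply/eqP; rewrite -[_ == 0](expf_eq0 _ 2).
  by rewrite eq_le z0 exprn_ge0 ?rnorm_ge0.
have Sw0 : S w = 0 by rewrite SE /= (zero _ B0) (adj0 (adj_sym BB)).
have Kw0 : K w = 0 by rewrite KE /= (zero _ G0) (adj0 (adj_sym GG)).
apply/eqP; rewrite -subr_eq0 -/w; apply/eqP/ipxx_eq0.
by rewrite {1}/w ipBl SA KA Sw0 Kw0 subrr.
Qed.

Section BoundedTransform.
Context {R : realType} {A : cstarType R} {E F : hilbertModType A}.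
Variable t : set (E * F).
Hypothesis t_reg : regular t.

(** The everywhere defined operators [(1 + t^* t)^{-1}] and [t (1 + t^* t)^{-1}]. *)
Definition resolvent v : E := xget 0 [set u | exists y, resolves t u y v].
Definition graph_resolvent v : F := xget 0 [set y | resolves t (resolvent v) y v].
Local Notation P := resolvent.
Local Notation Q := graph_resolvent.
Local Notation F_ := (bounded_transform t).

Lemma resolventP v : resolves t (P v) (Q v) v.
Proof.
have := resolvent_exists t_reg v => /(xgetPex 0 (P := [set u | exists y, resolves t u y v])).
by move=> /(xgetPex 0 (P := [set y | resolves t (P v) y v])).
Qed.

Lemma resolvent_adj : adj P P.
Proof.
have PE v v' : ip (P v) v' = ip (P v) (P v') + ip (Q v) (Q v').
  exact: graph_ip (resolventP v).1 (resolventP v').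
by move=> v v'; rewrite (PE v v') -[RHS]ip_star (PE v' v) cstarD !ip_star.
Qed.

Let X v := v - P v.

Fact resolventB_adj : adj X X.
Proof. by move=> u v; rewrite /X ipBl ipBr resolvent_adj. Qed.

Fact resolventB_bdd : bdd 1 X.
Proof. by move=> v; rewrite mul1r; case: (resolves_le (resolventP v)). Qed.

Local Notation S := (osqrt1B X).
Let SA : adj S S := osqrt1B_adj resolventB_adj resolventB_bdd.

Lemma osqrt_sqr v : S (S v) = P v.
Proof.
by rewrite (osqrt1B_sqr resolventB_adj resolventB_bdd) /X opprB addrC subrK.
Qed.

Lemma one_plusE x v : one_plus t (x, v) <-> P v = x.
Proof.
split=> [[y [z [/= xy yz vE]]]|<-].
  have xyv : resolves t x y v by split; rewrite // vE addrC addKr.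
  by have [] := resolves_uniq t_reg (resolventP v) xyv.
have [Pv Qv] := resolventP v; exists (Q v), (v - P v); split=> //=.
by rewrite addrC subrK.
Qed.

Lemma osqrt_positive : positive_op S.
Proof.
apply: pos_positive_op; split=> //; exists 1 => // x.
by rewrite scale1r mul1r (osqrt1B_dist resolventB_adj resolventB_bdd).
Qed.

(** The chosen root [T] satisfies [T^2 = P], so it commutes with [P], hence with [S], a limit of
    polynomials in [P]. Then [positive_root_uniq] applies. *)
Lemma inv_sqrtE : inv_sqrt t = S.
Proof.
have Sinv : is_inv_sqrt t S.
  by split=> [|v x]; [exact: osqrt_positive | rewrite osqrt_sqr one_plusE].
rewrite /inv_sqrt; have [pT TT] := xgetPex (fun=> 0) (ex_intro (is_inv_sqrt t) S Sinv).
set T := xget _ _ in pT TT *.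
have T2 v : T (T v) = P v by apply/TT/one_plusE.
have TA : adj T T.
  case: pT => [B [B' [[_ BB] ->]]]; exact: (adj_comp BB (adj_sym BB)).
(* The 2 is the square root of the constant in [rnorm_ip_le], applied to [ip (P v) v]. *)
have Tb : bdd 2 T.
  move=> v; rewrite -ler_sqr ?nnegrE ?mulr_ge0 ?rnorm_ge0 //.
  rewrite -rnorm_ipxx TA T2 (le_trans (rnorm_ip_le _ _)) // exprMn.
  have -> : 2 ^+ 2 = 4 :> R by rewrite expr2; ring.
  by rewrite ler_pM2l // expr2 ler_wpM2l ?rnorm_ge0 //; case: (resolves_le (resolventP v)).
apply: (positive_root_uniq pT osqrt_positive) => v; last by rewrite T2 osqrt_sqr.
apply: (osqrt1B_comm resolventB_adj resolventB_bdd TA _ Tb) => // z.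
by rewrite /X (adjB TA) -!T2.
Qed.

(** If [w = t x'] lay in the domain of the adjoint, [x'] would be the resolvent of [x' + t^* w]. In
    general [w] is only close to some [y] in that domain; with [z = t^* y], the resolvent of
    [x' + z] is still close to [x']. *)
Lemma resolvent_dense x (e : R) : 0 < e -> exists v, rnorm (x - P v) < e.
Proof.
(* The constant 4 of [rnorm_ip_le] leaves [x'] within [4 * (e / 9)] of the resolvent, hence [x]
   within [5 * (e / 9)]. *)
move=> e0; have e9 : 0 < e / 9 by rewrite divr_gt0.
have [_ _ t_dom ta_dom _] := t_reg.
have [x' [w x'w] xx'] := dense_rnorm x t_dom e9.
have [y [z yz] wy] := dense_rnorm w ta_dom e9.
exists (x' + z); set v := x' + z; have [Pv Qv] := resolventP v.
have rt := graphB t_reg x'w Pv; set u := P v in rt Pv Qv *; set q := Q v in rt Pv Qv.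
have ra : adjoint t (y - q, u - x').
  by have := adjointB yz Qv; congr (adjoint t (_, _)); rewrite /v; zmod_eq.
(* By ra, (x' - u, y - q) is orthogonal to the graph, where y is close to w. *)
have E1 : ip (x' - u) (x' - u) + ip (w - q) (w - q) = ip (w - q) (w - y).
  have := ra _ _ rt; rewrite /= -(opprB x' u) ipNr => E2.
  have -> : w - y = (w - q) - (y - q) by zmod_eq.
  by rewrite [in RHS]ipBr E2; zmod_eq.
have l1 := rnorm_ip_addl (x' - u) (w - q).
have l2 := rnorm_ip_addr (x' - u) (w - q).
have l3 := rnorm_ip_le (w - q) (w - y); rewrite E1 in l1 l2.
have l4 : rnorm (w - q) <= 4 * (e / 9).
  rewrite leNgt; apply/negP => lt; have := rnorm_ge0 (w - q).
  by move: l2 l3 wy lt; move: (rnorm (w - q)) (rnorm (w - y)) (rnorm (ip _ _)) => *; nra.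
have l5 : rnorm (x' - u) <= 4 * (e / 9).
  rewrite -ler_sqr ?nnegrE ?rnorm_ge0 ?mulr_ge0 ?(ltW e0) //.
  apply: le_trans l1 (le_trans l3 _); rewrite expr2 -[4 * (e / 9) * _]mulrA ler_pM2l //.
  by rewrite mulrC; apply: ler_pM; rewrite ?rnorm_ge0 // ltW.
have := rdistD x' x u.
by move: xx' l5; move: (rnorm _) (rnorm _) (rnorm _) => a b c; lra.
Qed.

End BoundedTransform.

(** * The bounded transform, its adjoint, and the projection onto the graph *)

Section BoundedTransformAdjoint.
Context {R : realType} {A : cstarType R} {E F : hilbertModType A}.
Variable t : set (E * F).
Hypothesis t_reg : regular t.
Local Notation P := (resolvent t).
Local Notation Q := (graph_resolvent t).
Local Notation S := (inv_sqrt t).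
Local Notation bt := (bounded_transform t).

Lemma inv_sqrt_adj : adj S S.
Proof.
rewrite inv_sqrtE //.
exact: osqrt1B_adj (resolventB_adj t_reg) (resolventB_bdd t_reg).
Qed.

Lemma inv_sqrt_sqr v : S (S v) = P v.
Proof. by rewrite inv_sqrtE // osqrt_sqr. Qed.

Lemma inv_sqrt_bdd : bdd 2 S.
Proof.
move=> v; rewrite inv_sqrtE //.
have := osqrt1B_dist (resolventB_adj t_reg) (resolventB_bdd t_reg) v.
set s := osqrt1B _ v; have := rdistD v s 0.
by rewrite !subr0 (rdistC s); move: (rnorm _) (rnorm _) (rnorm _) => a b c; lra.
Qed.

Lemma graph_resolventB v w : Q (v - w) = Q v - Q w.
Proof.
have [_ //] := resolves_uniq t_reg (resolventP t_reg (v - w))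
  (resolvesB t_reg (resolventP t_reg v) (resolventP t_reg w)).
Qed.

Lemma graph_resolvent_le w : rnorm (Q w) <= rnorm (S w).
Proof.
rewrite -ler_sqr ?nnegrE ?rnorm_ge0 // -[leRHS]rnorm_ipxx.
rewrite -inv_sqrt_adj inv_sqrt_sqr.
rewrite (graph_ip (resolventP t_reg w).1 (resolventP t_reg w)).
exact: rnorm_ip_addr.
Qed.

(** On vectors [S w] the operator [t S] is [Q w], of norm at most [rnorm (S w)]. These vectors are
    dense because the range of [P = S S] is, and closedness of [t] places every [S v] in the domain
    of [t]. *)
Lemma bounded_transform_approx v : t (S v, bt v) /\ forall e : R, 0 < e ->
  exists w, rnorm (v - S w) < e /\ rnorm (bt v - Q w) < e.
Proof.
have [_ t_cl _ _ _] := t_reg.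
(* A single value is extended; the second slot of [extend_dense] repeats it. *)
have [|x y z [w [-> -> ->]]|//|x e|y [y2 yP]] := @extend_dense R E F F
    (fun v y z => exists w, [/\ v = S w, y = Q w & z = Q w]) 1 _ _ _ _ v.
- move=> x y z x' y' z' [w [-> -> ->]] [w' [-> -> ->]].
  by exists (w - w'); rewrite (adjB inv_sqrt_adj) graph_resolventB.
- by rewrite mul1r graph_resolvent_le.
- move=> /(resolvent_dense t_reg x)[w xw].
  exists (S (S w)), (Q (S w)), (Q (S w)); split; first by exists (S w).
  by rewrite inv_sqrt_sqr.
have ty : t (S v, y).
  apply: (closed_prod_rnorm t_cl) => e e0; have e2 : 0 < e / 2 by rewrite divr_gt0.
  have [x' [y' [_ [[w [-> -> _]] vw yw _]]]] := yP _ e2.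
  exists (P w), (Q w); split; first by case: (resolventP t_reg w).
    rewrite -inv_sqrt_sqr -(adjB inv_sqrt_adj).
    by have := inv_sqrt_bdd (v - S w); lra.
  by lra.
have -> : bt v = y.
  apply: (graph_fun t_reg _ ty).
  exact: (xgetPex 0 (P := [set y | t (S v, y)]) (ex_intro _ y ty)).
split=> // e /yP[x' [y' [_ [[w [-> -> _]] vw yw _]]]].
by exists w.
Qed.

(** For [v' = S w] this is [graph_ip] at the graph point [(S v, bt v)]; the general case follows by
    approximating [v']. *)
Lemma isometry_ip v v' : ip (S v) (S v') + ip (bt v) (bt v') = ip v v'.
Proof.
have [tv _] := bounded_transform_approx v.
have [_ ap] := bounded_transform_approx v'.
apply/eqP; rewrite -subr_eq0; apply/eqP.
pose c := 4 * (rnorm (S v) * 2) + 4 * rnorm (bt v) + 4 * rnorm v.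
apply: (@rnorm_small _ _ _ c) => e /ap[w [vw btw]].
have E1 := graph_ip tv (resolventP t_reg w).
rewrite inv_sqrt_adj -inv_sqrt_sqr in E1.
have -> : ip (S v) (S v') + ip (bt v) (bt v') - ip v v' =
    ip (S v) (S (v' - S w)) + (ip (bt v) (bt v' - Q w) - ip v (v' - S w)).
  by rewrite (adjB inv_sqrt_adj) !ipBr E1; zmod_eq.
rewrite /c 2!mulrDl (le_trans (rnormD _ _)) // -addrA; apply: lerD.
  rewrite (le_trans (rnorm_ip_le _ _)) // -mulrA ler_pM2l // -mulrA.
  rewrite ler_wpM2l ?rnorm_ge0 // (le_trans (inv_sqrt_bdd _)) //.
  by rewrite ler_pM2l // ltW.
rewrite (le_trans (rnormB _ _)) //; apply: lerD.
  by rewrite (le_trans (rnorm_ip_le _ _)) // -mulrA ler_pM2l // ler_wpM2l ?rnorm_ge0 // ltW.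
by rewrite (le_trans (rnorm_ip_le _ _)) // -mulrA ler_pM2l // ler_wpM2l ?rnorm_ge0 // ltW.
Qed.

Lemma inv_sqrt_contr v : rnorm (S v) <= rnorm v.
Proof.
rewrite -ler_sqr ?nnegrE ?rnorm_ge0 // -[leRHS]rnorm_ipxx -isometry_ip.
exact: rnorm_ip_addl.
Qed.

Lemma bounded_transform_contr v : rnorm (bt v) <= rnorm v.
Proof.
rewrite -ler_sqr ?nnegrE ?rnorm_ge0 // -[leRHS]rnorm_ipxx -isometry_ip.
exact: rnorm_ip_addr.
Qed.

(** Bounded module maps may lack adjoints, so one is constructed: it is [S t^*] on the dense domain
    of [t^*], where it is bounded by 4, and it extends by continuity. *)
Lemma bounded_transform_adj : exists Fs, adj bt Fs.
Proof.
suff /choice[Fs FsP] : forall y, exists z, forall v, ip (bt v) y = ip v z.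
  by exists Fs => v y; rewrite FsP.
move=> y; have [_ _ _ ta_dom _] := t_reg.
have btS v y' z : adjoint t (y', z) -> ip (bt v) y' = ip v (S z).
  have [tv _] := bounded_transform_approx v.
  by move=> /(_ _ _ tv) /= ->; rewrite inv_sqrt_adj.
have [||//||z [z2 zP]] := @extend_dense R F E E
    (fun y s s' => exists z, [/\ adjoint t (y, z), s = S z & s' = S z]) 4 _ _ _ _ y.
- move=> x y1 z1 x' y' z' [w [xw -> ->]] [w' [xw' -> ->]].
  by exists (w - w'); rewrite (adjB inv_sqrt_adj); split=> //; exact: (adjointB xw xw').
- move=> {}y _ _ [z [yz -> ->]].
  suff : rnorm (S z) <= 4 * rnorm y by [].
  have [->|S0] := eqVneq (rnorm (S z)) 0; first by rewrite mulr_ge0 ?rnorm_ge0.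
  have Sz0 : 0 < rnorm (S z) by rewrite lt_neqAle eq_sym S0 rnorm_ge0.
  rewrite -(ler_pM2r Sz0) -expr2 -rnorm_ipxx -(btS _ _ _ yz).
  rewrite (le_trans (rnorm_ip_le _ _)) // -mulrA ler_pM2l // mulrC.
  by rewrite ler_wpM2l ?rnorm_ge0 // bounded_transform_contr.
- move=> x e /(dense_rnorm x ta_dom)[y' [z y'z] xy'].
  by exists y', (S z), (S z); split=> //; exists z.
exists z => v; apply/eqP; rewrite -subr_eq0; apply/eqP.
apply: (@rnorm_small _ _ _ (4 * rnorm (bt v) + 4 * rnorm v)) => e.
move=> /zP[y' [_ [_ [[z' [y'z' -> _]] yy' zz' _]]]].
have -> : ip (bt v) y - ip v z = ip (bt v) (y - y') - ip v (z - S z').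
  by rewrite !ipBr (btS _ _ _ y'z'); zmod_eq.
rewrite mulrDl (le_trans (rnormB _ _)) //; apply: lerD;
  by rewrite (le_trans (rnorm_ip_le _ _)) // -mulrA ler_pM2l // ler_wpM2l ?rnorm_ge0 // ltW.
Qed.

Variables (Fs : F -> E) (FsA : adj bt Fs).

Lemma isometry_id v : S (S v) + Fs (bt v) = v.
Proof.
by apply: eq_ipl => w; rewrite ipDr -inv_sqrt_adj -FsA isometry_ip.
Qed.

Lemma inv_sqrt_root : S = osqrt1B (Fs \o bt).
Proof.
rewrite {1}inv_sqrtE //; congr osqrt1B; apply: funext => v /=.
by rewrite -inv_sqrt_sqr -{1}[v]isometry_id addrC addKr.
Qed.

Lemma graphE x w : t (x, w) <-> exists v, x = S v /\ w = bt v.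
Proof.
split=> [xw|[v [-> ->]]]; last by case: (bounded_transform_approx v).
(* This is [v = V^* (x, w)]. The difference [(x, w) - V v] lies in the graph, so by [graph_ip]
   pairing its first component with [z] amounts to pairing the difference with [V (S z)], to which
   it is orthogonal. *)
pose v := S x + Fs w; have [tv _] := bounded_transform_approx v; exists v.
have xS : x = S v.
  apply/eqP; rewrite -subr_eq0; apply/eqP; apply: eq_ipr => z; rewrite ip0l.
  have Pz := resolventP t_reg z.
  rewrite (graph_ip (graphB t_reg xw tv) Pz).
  have -> : Q z = bt (S z).
    apply: (graph_fun t_reg Pz.1).
    by have [] := bounded_transform_approx (S z); rewrite inv_sqrt_sqr.
  rewrite -inv_sqrt_sqr !ipBl addrACA -opprD isometry_ip.
  by rewrite -inv_sqrt_adj -(adj_sym FsA) -ipD subrr.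
by split=> //; apply: (graph_fun t_reg xw); rewrite [in X in t (X, _)]xS.
Qed.

Lemma projE (u : E * F) : Defs.proj t u =
  (S (S u.1 + Fs u.2), bt (S u.1 + Fs u.2)).
Proof.
set v := S u.1 + Fs u.2.
apply: xget_unique.
  split; first by case: (bounded_transform_approx v).
  move=> [_ _] /graphE[z [-> ->]].
  rewrite /sum_ip /= !ipBl addrACA -opprD isometry_ip.
  by rewrite -inv_sqrt_adj -(adj_sym FsA) -ipD subrr.
move=> [_ _] [/graphE[z [-> ->]] h].
suff -> : z = v by [].
apply: eq_ipr => v'; have [tv _] := bounded_transform_approx v'.
have := h _ tv; rewrite /sum_ip /= !ipBl addrACA -opprD isometry_ip.
by rewrite -inv_sqrt_adj -(adj_sym FsA) -ipD => /eqP; rewrite subr_eq0 => /eqP.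
Qed.

End BoundedTransformAdjoint.
Lemma opnorm_ge0 (R : realType) (U V : Type) (nU : U -> R) (nV : V -> R)
    (T : U -> V) : (forall y, 0 <= nV y) -> 0 <= opnorm nU nV T.
Proof.
move=> nV0; rewrite /opnorm.
(* On a set without supremum [sup] takes the default value 0. *)
have [supT|/sup_out->//] := pselect (has_sup [set nV (T u) | u in [set u | nU u <= 1]]).
have [[_y [u u1 _]] _] := supT.
by apply: (le_trans (nV0 (T u))); apply: sup_upper_bound => //; exists u.
Qed.

(** * Comparison of the two metrics *)

Section SumNorm.
Context {R : realType} {A : cstarType R} {E F : hilbertModType A}.
Implicit Types u : E * F.

Lemma sum_norm_le u : sum_norm u <= rnorm u.1 + rnorm u.2.
Proof.
have s0 : 0 <= rnorm u.1 + rnorm u.2 by rewrite addr_ge0 ?rnorm_ge0.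
rewrite -[leRHS](ger0_norm s0) -sqrtr_sqr ler_wsqrtr //.
rewrite (le_trans (rnormD _ _)) // !rnorm_ipxx sqrrD -addrA lerD2l.
by rewrite lerDr mulrn_wge0 // mulr_ge0 ?rnorm_ge0.
Qed.

Lemma sum_norm_le1 u : sum_norm u <= 1 -> rnorm u.1 <= 1 /\ rnorm u.2 <= 1.
Proof.
move=> u1; have s1 : rnorm (sum_ip u u) <= 1.
  rewrite -[rnorm _]sqr_sqrtr ?rnorm_ge0 // exprn_ile1 // sqrtr_ge0.
by split; rewrite -(@expr_le1 _ 2) ?rnorm_ge0 // (le_trans _ s1) //;
  [exact: rnorm_ip_addl | exact: rnorm_ip_addr].
Qed.

End SumNorm.

Section Continuity.
Context {R : realType} {A : cstarType R} {E F : hilbertModType A}.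
Variables t s : set (E * F).
Hypotheses (t_reg : regular t) (s_reg : regular s).
Local Notation bt := (bounded_transform t).
Local Notation bs := (bounded_transform s).

Lemma opnorm_bounded_transformB v :
  rnorm (bt v - bs v) <=
    opnorm (@rnorm R E) (@rnorm R F) (bt \- bs) * rnorm v.
Proof.
have [Ft FtA] := bounded_transform_adj t_reg.
have [Fs FsA] := bounded_transform_adj s_reg.
have [->|v0] := eqVneq v 0.
  by rewrite (adj0 FtA) (adj0 FsA) subrr !rnorm0 mulr0.
have rv0 : 0 < rnorm v.
  rewrite lt_neqAle rnorm_ge0 andbT eq_sym.
  by apply: contra_neq v0; apply: rnorm_eq0.
have riv0 : 0 <= (rnorm v)^-1 by rewrite invr_ge0 ltW.
rewrite -ler_pdivrMr // mulrC -rnormZ_ge0 // scalerBr -(adjZ FtA) -(adjZ FsA).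
apply: sup_upper_bound; last first.
  by exists ((rnorm v)^-1%:C *: v) => //=; rewrite rnormZ_ge0 // mulVf // gt_eqF.
split; first by exists (rnorm ((bt \- bs) 0)), 0 => //=; rewrite rnorm0.
exists 2 => _ [u /= u1 <-].
have := bounded_transform_contr t_reg u; have := bounded_transform_contr s_reg u.
by have := rnormB (bt u) (bs u); lra.
Qed.

(** The adjoints are bounded by 4 and differ by [4 d], so the products [F^* F] differ by [8 d] and
    the roots by [k = 2 (1 - y n) + 8 n d]. The two components of the projections contribute
    [6 k + 4 d] and [k + 9 d], in total [7 k + 13 d]. *)
Lemma proj_dist d n u : 0 <= d ->
  (forall v, rnorm (bt v - bs v) <= d * rnorm v) -> sum_norm u <= 1 ->
  sum_norm (Defs.proj t u - Defs.proj s u) <=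
    14 * (1 - root_iter1 R n) + (56 * n%:R + 13) * d.
Proof.
move=> d0 dP /sum_norm_le1[u1 u2].
have [Ft FtA] := bounded_transform_adj t_reg.
have [Fs FsA] := bounded_transform_adj s_reg.
have root (r : set (E * F)) G : regular r -> adj (bounded_transform r) G ->
    [/\ adj (G \o bounded_transform r) (G \o bounded_transform r),
        bdd 1 (G \o bounded_transform r), bdd 4 G &
        inv_sqrt r = osqrt1B (G \o bounded_transform r)].
  move=> r_reg GA; split; last exact: inv_sqrt_root.
  - exact: (adj_comp GA (adj_sym GA)).
  - move=> v; rewrite -[X in rnorm X](addKr (inv_sqrt r (inv_sqrt r v))) /=.
    rewrite isometry_id // inv_sqrt_sqr // addrC.
    exact: (resolventB_bdd r_reg).
  - rewrite -[4]mulr1; apply: (adj_bdd GA ler01) => v; rewrite mul1r.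
    exact: bounded_transform_contr.
have [XtA Xt1 Ft4 St] := root _ _ t_reg FtA.
have [XsA Xs1 Fs4 Ss] := root _ _ s_reg FsA.
have dA : adj (fun v => bt v - bs v) (fun y => Ft y - Fs y).
  by move=> x y; rewrite ipBl ipBr FtA FsA.
have d4 := adj_bdd dA d0 dP.
have Xd v : rnorm ((Ft \o bt) v - (Fs \o bs) v) <= 8 * d * rnorm v.
  have -> : (Ft \o bt) v - (Fs \o bs) v = Ft (bt v - bs v) + (Ft (bs v) - Fs (bs v)).
    by rewrite (adjB (adj_sym FtA)) /= addrA subrK.
  rewrite (le_trans (rnormD _ _)) //.
  have b1 := Ft4 (bt v - bs v); have b2 := d4 (bs v).
  have b3 := dP v.
  have b4 := ler_wpM2l d0 (bounded_transform_contr s_reg v).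
  by lra.
have d80 : 0 <= 8 * d by rewrite mulr_ge0.
have Sd := osqrt1B_cont n XtA XsA Xt1 Xs1 d80 Xd; rewrite -St -Ss in Sd.
set k := 2 * _ + _ in Sd.
have k0 : 0 <= k.
  rewrite /k addr_ge0 ?mulr_ge0 // subr_ge0.
  by case/andP: (@root_iter1_01 R n).
rewrite (projE t_reg FtA) (projE s_reg FsA) (le_trans (sum_norm_le _)) //=.
set a := inv_sqrt t u.1 + _; set b := inv_sqrt s u.1 + _.
have ab : rnorm (a - b) <= k + 4 * d.
  have -> : a - b = (inv_sqrt t u.1 - inv_sqrt s u.1) + (Ft u.2 - Fs u.2).
    by rewrite /a /b; zmod_eq.
  rewrite (le_trans (rnormD _ _)) //; apply: lerD.
    by rewrite (le_trans (Sd _)) // ler_piMr.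
  by rewrite (le_trans (d4 _)) // ler_piMr // mulr_ge0.
have b5 : rnorm b <= 5.
  have := rnormD (inv_sqrt s u.1) (Fs u.2); rewrite -/b.
  by have := inv_sqrt_contr s_reg u.1; have := Fs4 u.2; lra.
have c1 : rnorm (inv_sqrt t a - inv_sqrt s b) <= k + 4 * d + 5 * k.
  have -> : inv_sqrt t a - inv_sqrt s b =
      inv_sqrt t (a - b) + (inv_sqrt t b - inv_sqrt s b).
    by rewrite (adjB (inv_sqrt_adj t_reg)) addrA subrK.
  rewrite (le_trans (rnormD _ _)) //; apply: lerD.
    by rewrite (le_trans (inv_sqrt_contr t_reg _)).
  by rewrite (le_trans (Sd _)) // mulrC ler_wpM2r.
have c2 : rnorm (bt a - bs b) <= k + 4 * d + 5 * d.
  have -> : bt a - bs b = bt (a - b) + (bt b - bs b).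
    by rewrite (adjB FtA) addrA subrK.
  rewrite (le_trans (rnormD _ _)) //; apply: lerD.
    by rewrite (le_trans (bounded_transform_contr t_reg _)).
  by rewrite (le_trans (dP _)) // mulrC ler_wpM2r.
by rewrite (le_trans (lerD c1 c2)) // /k; lra.
Qed.

End Continuity.

Theorem lemma2p5 (R : realType) (A : cstarType R) (E F : hilbertModType A)
    (U : set (regop E F)) :
  metric_open (@gap_dist R A E F) U -> metric_open (@riesz_dist R A E F) U.
Proof.
move=> gapU t /gapU[e e0 eU].
(* Here 42 is 3 times the 14 of [proj_dist]: the first term of that bound is below [e / 3], and the
   radius chosen next, which depends on [n], keeps the second below [e / 3]. *)
have [n ne] := root_iter1_cvg (divr_gt0 e0 (ltr0Sn R 41)).
have c0 : 0 < 56 * n%:R + 13 :> R by rewrite ltr_wpDl ?mulr_ge0.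
exists (e / 3 / (56 * n%:R + 13)) => [|s /= ts]; first by rewrite !divr_gt0.
apply: eU => /=; have [t_reg s_reg] := (svalP t, svalP s).
have dP := opnorm_bounded_transformB t_reg s_reg.
rewrite -/(riesz_dist t s) in dP ts.
rewrite ltr_pdivlMr // in ts.
have d0 : 0 <= riesz_dist t s by apply: opnorm_ge0; exact: rnorm_ge0.
have : gap_dist t s <= 14 * (1 - root_iter1 R n) + (56 * n%:R + 13) * riesz_dist t s.
  apply: ge_sup.
    exists (sum_norm ((Defs.proj (sval t) \- Defs.proj (sval s)) 0)), 0 => //=.
    by rewrite (le_trans (sum_norm_le _)) //= !rnorm0 addr0.
  by move=> _ [u u1 <-]; apply: proj_dist.
by lra.
Qed.
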